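(* Let $k$ be a field of characteristic different from $2$ containing a square root of $-1$, and let $q$ be an anisotropic quadratic form over $k$ with $q\simeq\langle a,b,ab,c,d,cd\rangle$ for some $a,b,c,d\in k^\times$ (so $q$ equals $\langle\langle a,b\rangle\rangle+\langle\langle c,d\rangle\rangle$ in $W(k)$). Let $D=(a,b)_k\otimes(c,d)_k$ and let $\sigma$ be the orthogonal involution on $D$ that is the tensor product of the canonical (conjugation) involutions of $(a,b)_k$ and $(c,d)_k$. Then for $\lambda\in k^\times$, we have $\mathrm{Pf}_2(\langle\lambda\rangle q)=2$ if and only if \[ \lambda^2=\mathrm{Nrd}_D(u)\quad\text{for some } u\in\mathrm{Sym}(D,\sigma). \]
   Context: $(a,b)_k$ denotes the quaternion algebra over $k$ with generators $i,j$, $i^2=a$, $j^2=b$, $ij=-ji$. $\mathrm{Nrd}_D$ is the reduced norm of $D$, and $\mathrm{Sym}(D,\sigma)=\{x\in D\mid\sigma(x)=x\}$. A $2$-fold Pfister form is $\langle\langle x,y\rangle\rangle=\langle 1,x,y,xy\rangle$; for a form $\varphi$ in $I^2(k)$ (the square of the fundamental ideal of the Witt ring $W(k)$), $\mathrm{Pf}_2(\varphi)$ is the least number of $2$-fold Pfister forms whose sum in $W(k)$ equals the Witt class of $\varphi$. *)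

(* Defs.v *)
From HB Require Import structures.
From mathcomp Require Import all_boot all_order all_algebra.
Set Implicit Arguments. Unset Strict Implicit. Unset Printing Implicit Defensive.
Import GRing.Theory.
Local Open Scope ring_scope.

Definition qf_val (k : fieldType) (s : seq k) (x : 'rV[k]_(size s)) : k :=
  \sum_(i < size s) s`_i * x 0 i ^+ 2.
Arguments qf_val : clear implicits.

Definition nondeg (k : fieldType) (s : seq k) : bool := all (fun a => a != 0) s.

Definition anisotropic (k : fieldType) (s : seq k) : Prop :=
  forall x : 'rV[k]_(size s), qf_val k s x = 0 -> x = 0.

Definition isometric (k : fieldType) (s t : seq k) : Prop :=
  exists P : 'M[k]_(size s, size t),
    [/\ row_free P, row_full P &
        forall x : 'rV[k]_(size s), qf_val k t (x *m P) = qf_val k s x].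

Definition hyp (k : fieldType) (m : nat) : seq k := flatten (nseq m [:: 1; -1]).

Definition witt_eq (k : fieldType) (s t : seq k) : Prop :=
  exists m n : nat, isometric (s ++ hyp k m) (t ++ hyp k n).

Definition scale (k : fieldType) (lam : k) (s : seq k) : seq k :=
  map (fun x => lam * x) s.

Definition pfister2 (k : fieldType) (x y : k) : seq k := [:: 1; x; y; x * y].

Definition sum_pf2 (k : fieldType) (l : seq (k * k)) : seq k :=
  flatten [seq pfister2 p.1 p.2 | p <- l].

Definition Pf2_rep (k : fieldType) (phi : seq k) (n : nat) : Prop :=
  exists l : seq (k * k),
    [/\ size l = n, all (fun p => (p.1 != 0) && (p.2 != 0)) l &
        witt_eq phi (sum_pf2 l)].

Definition Pf2_is (k : fieldType) (phi : seq k) (n : nat) : Prop :=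
  Pf2_rep phi n /\ forall m : nat, (m < n)%N -> ~ Pf2_rep phi m.

(** * Quaternion algebra (a,b)_k with basis e_0 = 1, e_1 = i, e_2 = j,
    e_3 = ij; e_p = i^(bit0 p) j^(bit1 p).  Then
    e_p e_r = (-1)^(bit1 p * bit0 r) a^(bit0 p * bit0 r) b^(bit1 p * bit1 r)
              e_(p xor r). *)

Definition qb0 (p : 'I_4) : bool := odd p.
Definition qb1 (p : 'I_4) : bool := odd p./2.

Definition qidx (p r : 'I_4) : nat :=
  (addb (qb0 p) (qb0 r) + 2 * addb (qb1 p) (qb1 r))%N.

Definition qcoef (k : fieldType) (a b : k) (p r : 'I_4) : k :=
  (-1) ^+ (qb1 p && qb0 r) * (if qb0 p && qb0 r then a else 1)
    * (if qb1 p && qb1 r then b else 1).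

(** * Biquaternion algebra D = (a,b)_k (x) (c,d)_k.  An element u is given
    by its coordinate matrix: u p q is the coefficient of e_p (x) f_q. *)

Definition bq_mul (k : fieldType) (a b c d : k) (u v : 'M[k]_4) : 'M[k]_4 :=
  \matrix_(s < 4, t < 4)
    (\sum_(p < 4) (\sum_(q < 4) (\sum_(r < 4) (\sum_(w < 4)
      (if (qidx p r == s) && (qidx q w == t)
       then qcoef a b p r * qcoef c d q w * u p q * v r w else 0))))).

(** sigma = tensor product of the canonical involutions:
    e_p (x) f_q |-> eps p * eps q * e_p (x) f_q *)
Definition qeps (k : fieldType) (p : 'I_4) : k := if val p == 0%N then 1 else -1.

Definition bq_sigma (k : fieldType) (u : 'M[k]_4) : 'M[k]_4 :=
  \matrix_(i < 4, j < 4) (qeps k i * qeps k j * u i j).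

Definition bq_Lmat (k : fieldType) (a b c d : k) (u : 'M[k]_4) : 'M[k]_(4 * 4) :=
  lin_mx (bq_mul a b c d u).

(** Reduced norm of the degree-4 central simple algebra D: the reduced
    characteristic polynomial Prd_u is the (unique) monic polynomial of
    degree 4 whose 4th power is the characteristic polynomial of left
    multiplication by u, and Nrd_D(u) = (-1)^4 Prd_u(0). *)
Definition bq_Nrd_is (k : fieldType) (a b c d : k) (u : 'M[k]_4) (x : k) : Prop :=
  exists p : {poly k},
    [/\ p \is monic, size p = 5%N, p ^+ 4 = char_poly (bq_Lmat a b c d u)
      & x = p`_0].

(* Main.v *)
(* The skew elements of (D, sigma) form a 6-dimensional space V on which
   s * s~ = q(s), where ~ changes the sign on the pure quaternions of (c,d); a
   square root of -1 makes this q equal to <a,b,ab,c,d,cd>, and Nrd(s) = q(s)^2.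

   If lambda q is a sum of two Pfister forms, Witt cancellation gives orthogonal
   s1, s2, s3 in V with lambda q(si) = x, y, xy.  Then s1~ s2 s3~ is symmetric, and
   u = lambda^2 (xy)^-1 s1~ s2 s3~ has reduced norm lambda^2.

   Conversely, let u be symmetric with Nrd(u) = lambda^2.  Since
   q(usu) = Nrd(u) q(s), the map s |-> (usu)~ squares to lambda^2, so one of its
   eigenvalues +-lambda, say lambda', has two orthogonal eigenvectors s1, s2.
   Then s3 = s1 u s2 is skew, orthogonal to s1 and s2, and
   q(s3) = - lambda' q(s1) q(s2); as q has trivial discriminant, both three-dimensional
   pieces of lambda q are pure parts of 2-fold Pfister forms. *)
Require Import Defs.
From mathcomp Require Import all_boot all_order all_algebra.
From mathcomp Require Import fieldext ring zify.
From Stdlib Require Import Classical_Prop.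
Set Implicit Arguments. Unset Strict Implicit. Unset Printing Implicit Defensive.
Import GRing.Theory.
Local Open Scope ring_scope.

(** * Congruence of diagonal forms *)

(** The reduced norm is defined over [k] through a fourth root of a characteristic polynomial of
    degree 16. The computations therefore move to an extension [L] in which [a] and [c] are squares:
    there D embeds in the 4 x 4 matrices and the reduced norm is a determinant. The way back to [k]
    rests on descent: a monic fourth root over [L] of a polynomial over [k] has its coefficients in
    [k].

    In the matrix model sigma is the adjoint involution of a symmetric matrix B, so B s is
    alternating for skew s, and its Pfaffian is -q(s). This yields Nrd(s) = q(s)^2 and also q(usu) =
    Nrd(u) q(s), which multiplicativity of the norm would give only up to sign; with the other sign
    the map s |-> (usu)~ would square to -lambda^2 and could lack eigenvectors for +-lambda.

    A sign is the obstacle for s3 as well: norms determine q(s3) only up to sign, and the right sign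
    comes out together with the orthogonality of s1 and s3. The ambiguity in lambda' is harmless
    because -1 is a square. Anisotropy makes the values q(si) nonzero and excludes fewer than two
    Pfister forms. *)

Section Forms.
Variable k : fieldType.
Implicit Types s t : seq k.

Definition gram s : 'M[k]_(size s) := diag_mx (\row_i s`_i).

(** The rows of [P] are vectors in the space of [t] whose Gram matrix is that of [s]. For
    nondegenerate [s] the equation forces [P] to be invertible, so it remains only to compare
    lengths. *)
Definition congruent s t :=
  exists P : 'M[k]_(size s, size t),
    size s = size t /\ P *m gram t *m P^T = gram s.

Lemma qf_valE s x : qf_val k s x = (x *m gram s *m x^T) 0 0.
Proof.
rewrite /qf_val mxE; apply: eq_bigr => i _.
by rewrite mul_mx_diag !mxE expr2 mulrA [x 0 i * _]mulrC.
Qed.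

Lemma gram_unit s : nondeg s -> gram s \in unitmx.
Proof.
move=> /allP ns; rewrite unitmxE det_diag unitfE; apply/prodf_neq0 => i _.
by rewrite mxE; apply: ns; apply: mem_nth.
Qed.

(** Polarization: the difference of the two sides is a symmetric matrix whose quadratic form
    vanishes, and its value at a sum of two basis vectors is twice an entry. *)
Lemma congr_mx_eq (m n : nat) (G : 'M[k]_m) (H : 'M[k]_n) (P : 'M_(m, n)) :
  2%:R != 0 :> k -> G^T = G -> H^T = H ->
  (forall x : 'rV_m, ((x *m P) *m H *m (x *m P)^T) 0 0 = (x *m G *m x^T) 0 0) ->
  P *m H *m P^T = G.
Proof.
move=> n2 sG sH eqf; apply/eqP; rewrite -subr_eq0; set D := _ - G.
have sD : D^T = D by rewrite /D !linearB /= !trmx_mul trmxK sG sH mulmxA.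
have D0 (x : 'rV_m) : (x *m D *m x^T) 0 0 = 0.
  rewrite /D mulmxBr mulmxBl; have := eqf x; rewrite trmx_mul !mulmxA => eqx.
  by apply/eqP; rewrite [X in X == _]mxE [X in _ + X]mxE eqx subrr.
apply/eqP/matrixP=> i j; rewrite [RHS]mxE.
have E (u v : 'I_m) : ((delta_mx 0 u : 'rV_m) *m D *m (delta_mx 0 v : 'rV_m)^T) 0 0 = D u v.
  by rewrite -rowE trmx_delta -colE !mxE.
have Dl (x y : 'rV_m) (z : 'cV_m) :
    ((x + y) *m D *m z) 0 0 = (x *m D *m z) 0 0 + (y *m D *m z) 0 0.
  by rewrite !mulmxDl mxE.
have Dr (x y z : 'rV_m) :
    (x *m D *m (y + z)^T) 0 0 = (x *m D *m y^T) 0 0 + (x *m D *m z^T) 0 0.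
  by rewrite [(y + z)^T]raddfD mulmxDr mxE.
have := D0 (delta_mx 0 i + delta_mx 0 j); rewrite Dl !Dr !D0 !E add0r addr0.
have -> : D j i = D i j by rewrite -{1}sD mxE.
by move/eqP; rewrite -mulr2n -mulr_natl mulf_eq0 (negPf n2) => /eqP.
Qed.

Lemma gram_sym s : (gram s)^T = gram s.
Proof. exact: tr_diag_mx. Qed.

Lemma isometricP s t : 2%:R != 0 :> k -> nondeg s ->
  isometric s t <-> congruent s t.
Proof.
move=> n2 ns; split=> [[P [fP uP eqf]]|[P [est eP]]]; exists P.
  split; first exact: etrans (esym (eqP fP)) (eqP uP).
  apply: congr_mx_eq; rewrite ?gram_sym // => x.
  by rewrite -!qf_valE eqf.
have rP : \rank P = size s.
  apply/eqP; rewrite eqn_leq rank_leq_row /= -[X in (X <= _)%N](mxrank_unit (gram_unit ns)).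
  by rewrite -eP -mulmxA mxrankM_maxl.
split; rewrite /row_free /row_full ?rP ?est // => x.
by rewrite !qf_valE -eP trmx_mul !mulmxA.
Qed.

Lemma congruent_trans t s r : congruent s t -> congruent t r -> congruent s r.
Proof.
move=> [P [e1 eP]] [Q [e2 eQ]]; exists (P *m Q); split; first by rewrite e1.
by rewrite trmx_mul -eP -eQ !mulmxA.
Qed.

Lemma congruent_refl s : congruent s s.
Proof. by exists 1%:M; rewrite mul1mx trmx1 mulmx1. Qed.

Lemma congruent_sym s t : nondeg s -> congruent s t -> congruent t s.
Proof.
move=> /gram_unit; rewrite /congruent; move: (gram s) (gram t) => G H uG [P [est]].
move: (size s) (size t) est P G H uG => m n emn; case: n / emn => P G H uG eP.
have uP : P \in unitmx by move: uG; rewrite -eP !unitmx_mul => /andP[/andP[]].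
exists (invmx P); split=> //.
by rewrite -eP !mulmxA mulVmx // mul1mx -mulmxA -trmx_mul mulVmx // trmx1 mulmx1.
Qed.

Lemma gram_cons x s : gram (x :: s) = block_mx x%:M 0 0 (gram s) :> 'M_(1 + size s).
Proof.
apply/matrixP=> i j; rewrite [RHS]mxE.
case: (splitP i) => i' ei; rewrite [RHS]mxE; case: (splitP j) => j' ej; rewrite !mxE -!val_eqE /= ei ej.
- by rewrite !ord1.
- by rewrite !ord1.
- by rewrite !ord1.
- by rewrite add1n /= eqSS.
Qed.

Lemma block_diag_congr (m1 m2 n1 n2 : nat) (A : 'M[k]_(m1, n1)) (B : 'M_(m2, n2)) G H :
  block_mx A 0 0 B *m block_mx G 0 0 H *m (block_mx A 0 0 B)^T
    = block_mx (A *m G *m A^T) 0 0 (B *m H *m B^T).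
Proof.
by rewrite tr_block_mx !mulmx_block !trmx0 !(mul0mx, mulmx0, addr0, add0r).
Qed.

Lemma congruent_cons x s t : congruent s t -> congruent (x :: s) (x :: t).
Proof.
move=> [P [est eP]]; exists (block_mx 1%:M 0 0 P : 'M_(1 + size s, 1 + size t)).
split; first by rewrite /= est.
rewrite !gram_cons; apply: etrans (@block_diag_congr 1 (size s) 1 (size t) _ _ _ _) _.
by rewrite eP trmx1 mulmx1 mul1mx.
Qed.

Lemma congruent_swap x y s : congruent (x :: y :: s) (y :: x :: s).
Proof.
pose P0 : 'M[k]_(2) := \matrix_(i, j) (i != j)%:R.
exists (block_mx P0 0 0 1%:M : 'M_(2 + size s)); split=> //.
have E u v : gram [:: u, v & s] = block_mx (gram [:: u; v]) 0 0 (gram s) :> 'M_(2 + size s).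
  apply/matrixP=> i j; rewrite [RHS]mxE.
  case: (splitP i) => i' ei; rewrite [RHS]mxE; case: (splitP j) => j' ej; rewrite !mxE -!val_eqE /= ei ej.
  - by case: i' j' {ei ej} => [[|[|]]] // ? [[|[|]]].
  - by case: i' {ei ej} => [[|[|]]].
  - by case: j' {ei ej} => [[|[|]]].
  - by rewrite !add2n /= !eqSS.
rewrite !E; apply: etrans (@block_diag_congr 2 (size s) 2 (size s) _ _ _ _) _.
rewrite trmx1 mulmx1 mul1mx; congr block_mx; apply/matrixP=> i j; rewrite mxE !big_ord_recl big_ord0 !mxE !big_ord_recl !big_ord0 !mxE.
by case: i j => [[|[|]]] // ? [[|[|]]] // ?; rewrite /= !(mulr0n, mulr1n, mul0r, mulr0, mul1r, mulr1, addr0, add0r).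
Qed.

Lemma congruent_perm s t : perm_eq s t -> congruent s t.
Proof.
have front x r1 r2 : congruent (x :: r1 ++ r2) (r1 ++ x :: r2).
  elim: r1 => [|y r1 IH]; first exact: congruent_refl.
  exact: congruent_trans (congruent_swap _ _ _) (congruent_cons y IH).
elim: s t => [|x s IH] t; first by rewrite perm_sym => /perm_nilP ->; apply: congruent_refl.
move=> pst; have xt : x \in t by rewrite -(perm_mem pst) mem_head.
case/splitPr: xt pst => t1 t2; rewrite perm_sym perm_catC /= perm_cons => pst.
apply: congruent_trans (front x t1 t2); apply/congruent_cons/IH.
by rewrite perm_sym perm_catC.
Qed.

Lemma congruent_sqr x r s : congruent (x * r ^+ 2 :: s) (x :: s).
Proof.
exists (block_mx r%:M 0 0 1%:M : 'M_(1 + size s)); split=> //.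
rewrite !gram_cons; apply: etrans (@block_diag_congr 1 (size s) 1 (size s) _ _ _ _) _.
by rewrite trmx1 mulmx1 mul1mx tr_scalar_mx -!scalar_mxM -mulrA mulrCA -expr2.
Qed.

(* The witness is the lower block of the isometry followed by the reflection
   that moves its first row to minus the first basis vector. *)
Lemma congr_cancel_corner (m n : nat) (G : 'M[k]_m) (H : 'M[k]_n) e al
    (r : 'rV_n) (c : 'cV_m) (Q : 'M_(m, n)) :
  H^T = H -> 1 + al != 0 ->
  (al ^+ 2 * e)%:M + r *m H *m r^T = e%:M ->
  (al * e) *: c^T + r *m H *m Q^T = 0 ->
  e *: (c *m c^T) + Q *m H *m Q^T = G ->
  exists Q' : 'M_(m, n), Q' *m H *m Q'^T = G.
Proof.
move=> sH al1 E1 E2 <-; pose be := (1 + al)^-1; exists (Q - be *: (c *m r)).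
have rHQ : r *m H *m Q^T = - (al * e) *: c^T.
  by rewrite scaleNr; apply/eqP; rewrite -addr_eq0 addrC E2.
have QHr : Q *m H *m r^T = - (al * e) *: c.
  by apply: trmx_inj; rewrite !trmx_mul trmxK sH mulmxA rHQ linearZ.
have rHr : r *m H *m r^T = (e - al ^+ 2 * e)%:M.
  by rewrite raddfB /= -E1 addrC addKr.
pose X := c *m c^T; pose R := be *: (c *m r).
have RT : R^T = be *: (r^T *m c^T) by rewrite linearZ /= trmx_mul.
have T1 : Q *m H *m R^T = - (be * (al * e)) *: X.
  by rewrite RT -scalemxAr mulmxA QHr -scalemxAl scalerA mulrN.
have T2 : R *m H *m Q^T = - (be * (al * e)) *: X.
  by rewrite -!scalemxAl -!mulmxA (mulmxA r) rHQ -scalemxAr scalerA mulrN.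
have T3 : R *m H *m R^T = (be ^+ 2 * (e - al ^+ 2 * e)) *: X.
  rewrite RT -!scalemxAl -!scalemxAr scalerA -expr2 -!mulmxA (mulmxA H) (mulmxA r) (mulmxA r).
  by rewrite rHr mul_scalar_mx -scalemxAr scalerA.
rewrite [(_ - _)^T]raddfB /= mulmxBr !mulmxBl T1 T2 T3 -!scaleNr opprK -addrA -!scalerDl addrC.
rewrite -scaleNr -scalerDl; congr (_ *: _ + _); rewrite /be; by field.
Qed.

Lemma congr_cancel (m n : nat) (G : 'M[k]_m) (H : 'M[k]_n) e (P : 'M_(1 + m, 1 + n)) :
  2%:R != 0 :> k -> H^T = H ->
  P *m block_mx e%:M 0 0 H *m P^T = block_mx e%:M 0 0 G ->
  exists Q : 'M_(m, n), Q *m H *m Q^T = G.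
Proof.
move=> n2 sH; rewrite -[P]submxK tr_block_mx !mulmx_block.
rewrite !(mulmx0, mul0mx, addr0, add0r) => /eq_block_mx[].
rewrite [ulsubmx P]mx11_scalar; move: (ulsubmx P 0 0) (ursubmx P) (dlsubmx P) (drsubmx P).
move=> al r c Q; rewrite tr_scalar_mx -!scalar_mxM !mul_scalar_mx !mul_mx_scalar -!scalemxAl.
rewrite mulrAC -expr2 => E1 E2 _ E3.
(* A corner entry -1 becomes 1 after a sign change of the first vector. *)
have [al1|al1] := eqVneq (1 + al) 0; last exact: congr_cancel_corner E1 E2 E3.
apply: (@congr_cancel_corner _ _ G _ e (- al) r (- c) Q) => //.
- by rewrite -(addr0_eq al1) opprK -mulr2n.
- by rewrite sqrrN.
- by rewrite raddfN /= mulNr scaleNr scalerN opprK.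
- by rewrite raddfN /= mulNmx mulmxN opprK.
Qed.

Lemma congruent_cancel e s t : 2%:R != 0 :> k ->
  congruent (e :: s) (e :: t) -> congruent s t.
Proof.
move=> n2 [P [[est]]]; rewrite !gram_cons => eP.
by have [Q eQ] := congr_cancel n2 (gram_sym t) eP; exists Q.
Qed.

End Forms.

(** * Witt equivalence and Pfister numbers of six-dimensional forms *)

Section WittEquivalence.
Variable k : fieldType.
Implicit Types s t r : seq k.

(** A Gram matrix whose size is a free parameter, so that forms whose lengths are only
    propositionally equal share one matrix space. *)
Definition gram_size n s : 'M[k]_n := diag_mx (\row_i s`_i).

Lemma congruent_sizeP n s t : size s = n -> size t = n ->
  congruent s t <-> exists P : 'M_n, P *m gram_size n t *m P^T = gram_size n s.
Proof.
move=> es et; rewrite /congruent /gram /gram_size.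
move: (nth 0 s) (nth 0 t) => f g; case: n / es et; move: (size s) => n et.
move: (size t) (esym et) => m em; case: m / em.
by split=> [[P [_ eP]]|[P eP]]; exists P.
Qed.

Lemma congruent_size s t : congruent s t -> size s = size t.
Proof. by case=> P []. Qed.

Lemma congruent_scale lam s t :
  congruent s t -> congruent (scale lam s) (scale lam t).
Proof.
have E n r : size r = n -> gram_size n (scale lam r) = lam *: gram_size n r.
  by move=> <-; apply/matrixP=> i j; rewrite !mxE (nth_map 0) ?ltn_ord // mulrnAr.
move=> st; have est := esym (congruent_size st).
have [P eP] := (congruent_sizeP erefl est).1 st.
apply/(@congruent_sizeP (size s)); rewrite ?size_map ?est //; exists P.
by rewrite !E // -scalemxAr -scalemxAl eP.
Qed.

Lemma congruent_cancel_cat r s t : 2%:R != 0 :> k ->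
  congruent (r ++ s) (r ++ t) -> congruent s t.
Proof. by move=> n2; elim: r => //= x r IH /(congruent_cancel n2). Qed.

Lemma congruent_cancel_catr r s t : 2%:R != 0 :> k ->
  congruent (s ++ r) (t ++ r) -> congruent s t.
Proof.
move=> n2 st; apply: (@congruent_cancel_cat r) => //.
apply: congruent_trans (congruent_trans _ st) _.
  by apply: congruent_perm; rewrite perm_catC.
by apply: congruent_perm; rewrite perm_catC.
Qed.

Lemma congruent_cat r s t : congruent s t -> congruent (r ++ s) (r ++ t).
Proof. by move=> st; elim: r => //= x r; apply: congruent_cons. Qed.

Lemma congruent_catr r s t : congruent s t -> congruent (s ++ r) (t ++ r).
Proof.
move=> /(congruent_cat r) st.
apply: congruent_trans (congruent_trans _ st) _.
  by apply: congruent_perm; rewrite perm_catC.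
by apply: congruent_perm; rewrite perm_catC.
Qed.

Lemma anisotropic_isometric s t :
  isometric s t -> anisotropic s -> anisotropic t.
Proof.
move=> [P [_ fP eqf]] an y y0; have /an x0 : qf_val k s (y *m pinvmx P) = 0.
  by rewrite -eqf mulmxKpV ?submx_full.
by rewrite -[y](@mulmxKpV _ _ _ _ y P) ?submx_full // x0 mul0mx.
Qed.

Lemma anisotropic_nondeg s : anisotropic s -> nondeg s.
Proof.
move=> an; apply/allP=> _ /(nthP 0)[i lti <-]; apply/eqP=> si0.
have /an/rowP/(_ (Ordinal lti))/eqP: qf_val k s (delta_mx 0 (Ordinal lti)) = 0.
  rewrite /qf_val (bigD1 (Ordinal lti)) //= si0 mul0r add0r big1 // => j ne.
  by rewrite mxE (negPf ne) andbF expr0n mulr0.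
by rewrite !mxE !eqxx oner_eq0.
Qed.

Lemma anisotropic_scale lam s :
  lam != 0 -> anisotropic s -> anisotropic (scale lam s).
Proof.
move=> l0; rewrite /anisotropic /qf_val.
have N i : (i < size s)%N -> (scale lam s)`_i = lam * s`_i.
  by move=> ?; rewrite (nth_map 0).
move: (nth 0 (scale lam s)) N (size_map (fun x => lam * x) s) => f N.
move: (size (scale lam s)) => m /esym em; case: m / em.
move=> an x x0; apply: an; apply: (mulfI l0); rewrite mulr0 -[RHS]x0 mulr_sumr.
by apply: eq_bigr => i _; rewrite N // mulrA.
Qed.

Lemma anisotropic_hyperbolic r : ~ anisotropic [:: 1, -1 & r].
Proof.
move=> /(_ (\row_i (i < 2)%:R)) an.
have /an/rowP/(_ ord0)/eqP : qf_val k [:: 1, -1 & r] (\row_i (i < 2)%:R) = 0.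
  rewrite /qf_val /= !big_ord_recl big1 => [|i _]; rewrite !mxE /= ?expr0n ?mulr0 //.
  by rewrite !expr1n !mulr1 addr0 subrr.
by rewrite !mxE oner_eq0.
Qed.

Lemma size_hyp m : size (hyp k m) = m.*2.
Proof. by elim: m => //= m ->. Qed.

Lemma nondeg_hyp m : nondeg (hyp k m).
Proof. by elim: m => //= m ->; rewrite oppr_eq0 oner_eq0. Qed.

Lemma hypD m n : hyp k (m + n) = hyp k m ++ hyp k n.
Proof. by rewrite /hyp nseqD flatten_cat. Qed.

Hypothesis n2 : 2%:R != 0 :> k.

(** Comparing lengths shows that the numbers of added planes differ by exactly [d]; the common
    planes are removed by cancellation. *)
Lemma witt_eq_cancel s t d : size t = (size s + d.*2)%N -> nondeg s ->
  witt_eq s t <-> congruent (s ++ hyp k d) t.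
Proof.
move=> et ns; have nd m : nondeg (s ++ hyp k m)
  by rewrite /nondeg all_cat; apply/andP; split; [|apply: nondeg_hyp].
split=> [[m [n /(isometricP _ n2 (nd m)) cst]]|cst]; last first.
  by exists d, 0%N; rewrite cats0; apply/isometricP.
have := congruent_size cst; rewrite !size_cat !size_hyp et => eq1.
have em : m = (d + n)%N by lia.
by apply: (@congruent_cancel_catr (hyp k n)) => //; rewrite -catA -hypD -em.
Qed.

Variable i : k.
Hypothesis i2 : i ^+ 2 = -1.

Lemma congruent_neg x s : congruent (x :: s) (- x :: s).
Proof.
have {1}-> : x = - x * i ^+ 2 by rewrite i2 mulrN1 opprK.
exact: congruent_sqr.
Qed.

(** Since -1 is a square, a hyperbolic plane is also <1, 1>, which supplies the two unit entries of
    the Pfister forms. *)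
Lemma congruent_pfister2_pair x y z w :
  congruent ([:: x; y; x * y; z; w; z * w] ++ hyp k 1)
    (pfister2 x y ++ pfister2 z w).
Proof.
apply: (@congruent_trans _ ([:: x; y; x * y; z; w; z * w] ++ [:: 1; 1])).
  apply/congruent_cat/congruent_cons; rewrite -{2}[1]opprK.
  exact: congruent_neg.
by apply: congruent_perm; apply/permP=> p /=; lia.
Qed.

Lemma Pf2_rep2P s : size s = 6 -> nondeg s ->
  Pf2_rep s 2 <-> exists x y z w : k,
    [/\ x != 0, y != 0, z != 0 & w != 0] /\
    congruent s [:: x; y; x * y; z; w; z * w].
Proof.
move=> s6 ns; split=> [[l []]|[x [y [z [w [[x0 y0 z0 w0] cs]]]]]].
  case: l => [|[x y] [|[z w] []]] // _ /and3P[/andP[/= x0 y0] /andP[/= z0 w0] _].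
  move=> wl; have cs : congruent (s ++ hyp k 1) (sum_pf2 [:: (x, y); (z, w)]).
    by apply/witt_eq_cancel => //; rewrite s6.
  exists x, y, z, w; split=> //; apply: (@congruent_cancel_catr (hyp k 1)) => //.
  apply: congruent_trans cs (congruent_sym _ (congruent_pfister2_pair _ _ _ _)).
  by rewrite /nondeg /= !mulf_neq0 // x0 y0 z0 w0 oppr_eq0 oner_eq0.
exists [:: (x, y); (z, w)]; split; rewrite //= ?x0 ?y0 ?z0 ?w0 //.
apply/(@witt_eq_cancel _ _ 1) => //; first by rewrite s6.
exact: congruent_trans (congruent_catr _ cs) (congruent_pfister2_pair _ _ _ _).
Qed.

(** Against a sum of zero or one Pfister forms, of dimension 0 or 4, a six-dimensional form would
    split off three planes or one plane and so be isotropic. *)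
Lemma anisotropic_Pf2_ge2 s m : size s = 6 -> anisotropic s -> (m < 2)%N ->
  ~ Pf2_rep s m.
Proof.
move=> s6 an; have ns := anisotropic_nondeg an.
have H r : congruent s [:: 1, -1 & r] -> False.
  move=> cs; apply: (@anisotropic_hyperbolic r).
  by apply: anisotropic_isometric an; apply/isometricP.
have W t d : (size t + d.*2)%N = 6 -> witt_eq s t -> congruent s (hyp k d ++ t).
  move=> et [m' [n /isometricP cst]].
  have {}cst : congruent (s ++ hyp k m') (t ++ hyp k n).
    by apply: cst => //; rewrite /nondeg all_cat; apply/andP; split; [|apply: nondeg_hyp].
  have := congruent_size cst; rewrite !size_cat !size_hyp s6 => eq1.
  have em : n = (d + m')%N by lia.
  move: cst; rewrite em hypD catA => /(congruent_cancel_catr n2) cst.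
  by apply: congruent_trans cst _; apply: congruent_perm; rewrite perm_catC.
move=> lt2 [l [sl _ wl]]; case: m lt2 sl => [|[|//]] _.
  by case: l wl => // /(W [::] 3%N erefl)/H.
by case: l wl => [|[x y] []] // /(W (pfister2 x y) 1%N erefl)/H.
Qed.

End WittEquivalence.

(** * Splitting fields and descent of fourth roots *)

(** Adjoining a root requires [X^2 - a] irreducible, hence the classical case split: if [a] is
    already a square, [L] is [k] itself. *)
Lemma sqrt_extension (k : fieldType) (a : k) :
  exists (L : fieldType) (f : {rmorphism k -> L}) (r : L), r ^+ 2 = f a.
Proof.
have sz : size ('X^2 - a%:P) = 3 by rewrite size_XnsubC.
have [[r ra]|nr] := classic (exists r, r ^+ 2 = a); first by exists k, idfun, r.
have /irredp_FAdjoin[L _ [z rz _]] : irreducible_poly ('X^2 - a%:P).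
  apply: cubic_irreducible; rewrite ?sz // => r; apply/negP.
  by rewrite /root !hornerE subr_eq0 => /eqP ra; apply: nr; exists r.
exists L, (in_alg L), z; apply/eqP; move: rz.
by rewrite rmorphB /= map_polyXn map_polyC /= /root !hornerE subr_eq0.
Qed.

(* If [P = p + R] with [p] over [k] monic of the same degree, the leading
   coefficient of [P ^+ 4 - p ^+ 4] is 4 times that of [R]: this determines the
   coefficients of [P] one by one from the top. *)
Lemma fourth_root_descent (k L : fieldType) (f : {rmorphism k -> L})
    (P : {poly L}) (Q : {poly k}) :
  2%:R != 0 :> k -> P \is monic -> P ^+ 4 = map_poly f Q ->
  exists p : {poly k}, map_poly f p = P.
Proof.
move=> n2 mP eP.
have n2L : 2%:R != 0 :> L by rewrite -(rmorph_nat f) fmorph_eq0.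
have n4L : 4%:R != 0 :> L by rewrite (natrM _ 2 2) mulf_neq0.
have lt0P : (0 < size P)%N by rewrite lt0n size_poly_eq0 monic_neq0.
suff H (n : nat) (p : {poly k}) : p \is monic -> size p = size P ->
    (size (P - map_poly f p)%R <= n)%N -> (n < size P)%N ->
    exists p : {poly k}, map_poly f p = P.
  have e0 := H (size P).-1 ('X^((size P).-1)); apply: e0; rewrite ?monicXn ?size_polyXn //.
  - by rewrite prednK.
  - rewrite map_polyXn; apply/leq_sizeP=> j lej; rewrite coefB coefXn.
    have [->|ne] := eqVneq j (size P).-1; first by rewrite -/(lead_coef P) (eqP mP) subrr.
    by rewrite nth_default ?subrr // -(prednK lt0P) ltn_neqAle eq_sym ne.
  - by rewrite prednK.
elim: n p => [|n IH] p mp sp.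
  by rewrite leqn0 size_poly_eq0 subr_eq0 => /eqP eqp _; exists p.
set R := P - _ => sR ltn; have [Rn|Rn] := leqP (size R) n; first exact: IH Rn (ltnW ltn).
have {}sR : size R = n.+1 by apply/eqP; rewrite eqn_leq sR.
pose p1 := map_poly f p.
have m1 : p1 \is monic by rewrite map_monic.
have s1 : size p1 = size P by rewrite size_map_poly.
have sums (A B : {poly L}) al be : size A = size B -> lead_coef A = al -> lead_coef B = be ->
  al + be != 0 -> lead_coef (A + B) = al + be /\ size (A + B) = size A.
  move=> sAB lA lB nz.
  have sz : size (A + B) = size A.
    apply/eqP; rewrite eqn_leq (leq_trans (size_polyD _ _)) ?sAB ?maxnn //=.
    rewrite leqNgt; apply/negP=> lt; case/negP: nz; apply/eqP.
    rewrite -lA -lB /lead_coef sAB -coefD; apply: nth_default.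
    by rewrite -ltnS (leq_trans lt) // leqSpred.
  by split=> //; rewrite {1}/lead_coef sz coefD -lA -lB /lead_coef sAB.
have lP : lead_coef P = 1 by apply/eqP.
have l1 : lead_coef p1 = 1 by apply/eqP.
have [lA _] := sums _ _ _ _ (esym s1) lP l1 n2L.
have [lB _] : lead_coef (P ^+ 2 + p1 ^+ 2) = 1 + 1 /\ size (P ^+ 2 + p1 ^+ 2) = size (P ^+ 2).
  apply: sums; rewrite ?lead_coef_exp ?lP ?l1 ?expr1n //.
  by rewrite !expr2 !size_proper_mul ?lP ?l1 ?mulr1 ?oner_eq0 // s1.
have [c ec] : exists c, f c = lead_coef R.
  pose D := Q - p ^+ 4.
  exists (lead_coef D / 4%:R).
  rewrite fmorph_div rmorph_nat -lead_coef_map /D rmorphB rmorphXn /= -eP -/p1.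
  have -> : P ^+ 4 - p1 ^+ 4 = R * ((P + p1) * (P ^+ 2 + p1 ^+ 2)) by rewrite /R -/p1; ring.
  rewrite !lead_coefM lA lB (_ : (1 + 1) * (1 + 1) = 4%:R) ?mulfK //.
  by ring.
have szc : (size (c *: 'X^n) < size p)%N.
  by rewrite (leq_ltn_trans (size_scale_leq _ _)) // size_polyXn sp.
apply: (IH (p + c *: 'X^n)) (ltnW ltn).
- by rewrite monicE lead_coefDl // (eqP mp).
- by rewrite size_polyDl.
- rewrite rmorphD /= linearZ /= map_polyXn opprD addrA -/p1 -[P - _]/R ec.
  apply/leq_sizeP=> j lej; rewrite coefB coefZ coefXn.
  have [->|ne] := eqVneq j n; first by rewrite mulr1 /lead_coef sR subrr.
  by rewrite mulr0 nth_default ?subrr // sR ltn_neqAle eq_sym ne.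
Qed.

(** * Kronecker products of 2 x 2 matrices *)

Section Kronecker.
Variable R : comPzRingType.

Definition hi_bit (i : 'I_4) : 'I_2 := inord i./2.
Definition lo_bit (i : 'I_4) : 'I_2 := inord (odd i).
Definition kron (X Y : 'M[R]_2) : 'M_4 :=
  \matrix_(i, j) (X (hi_bit i) (hi_bit j) * Y (lo_bit i) (lo_bit j)).

Lemma sum_hi_lo (V : nmodType) (F : 'I_2 -> 'I_2 -> V) :
  \sum_i F (hi_bit i) (lo_bit i) = \sum_i \sum_j F i j.
Proof.
rewrite pair_bigA /=.
pose g (p : 'I_2 * 'I_2) : 'I_4 := inord (p.2 + p.1.*2).
have gv p : g p = (p.2 + p.1.*2)%N :> nat.
  by case: p => [[[|[|]]] // ? [[|[|]]] // ?]; rewrite inordK.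
have hg p : hi_bit (g p) = p.1.
  by apply: val_inj; rewrite /= inordK gv; case: p => [[[|[|]]] // ? [[|[|]]] // ?].
have lg p : lo_bit (g p) = p.2.
  by apply: val_inj; rewrite /= inordK gv; case: p => [[[|[|]]] // ? [[|[|]]] // ?].
have gK : cancel (fun i => (hi_bit i, lo_bit i)) g.
  by case=> [[|[|[|[|]]]]] // ?; apply: val_inj; rewrite [LHS]gv /= !inordK.
rewrite (reindex g) /=; last by exists (fun i => (hi_bit i, lo_bit i)) => [[x y]|x] _ //=; rewrite ?hg ?lg ?gK.
by apply: eq_bigr => p _; rewrite hg lg.
Qed.

Lemma kron_mul X Y X' Y' : kron X Y *m kron X' Y' = kron (X *m X') (Y *m Y').
Proof.
apply/matrixP=> i j; rewrite !mxE.
under eq_bigr do rewrite !mxE.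
rewrite (sum_hi_lo (fun r w => X (hi_bit i) r * Y (lo_bit i) w * (X' r (hi_bit j) * Y' w (lo_bit j)))).
rewrite mulr_suml; apply: eq_bigr => r _; rewrite mulr_sumr; apply: eq_bigr => w _.
by rewrite mulrACA.
Qed.

Lemma kron_tr X Y : \tr (kron X Y) = \tr X * \tr Y.
Proof.
rewrite /mxtrace; under eq_bigr do rewrite mxE.
rewrite (sum_hi_lo (fun r w => X r r * Y w w)).
by rewrite mulr_suml; apply: eq_bigr => r _; rewrite mulr_sumr.
Qed.

Lemma kronZl a X Y : kron (a *: X) Y = a *: kron X Y.
Proof. by apply/matrixP=> i j; rewrite !mxE mulrA. Qed.

Lemma kronZr a X Y : kron X (a *: Y) = a *: kron X Y.
Proof. by apply/matrixP=> i j; rewrite !mxE mulrCA. Qed.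

Definition conj2 (X : 'M[R]_2) : 'M_2 :=
  \matrix_(i, j) ((-1) ^+ (i != j) * X (rev_ord j) (rev_ord i)).

(** The antidiagonal of the tensor square of the matrix with rows 0, 1 and -1, 0 reads 1, -1, -1,
    1. *)
Definition sgn4 (i : 'I_4) : R := (-1) ^+ ((i == 1%N :> nat) || (i == 2%N :> nat)).

Lemma sgn4_rev i : sgn4 (rev_ord i) = sgn4 i.
Proof. by case: i => [[|[|[|[|]]]]]. Qed.

Lemma sgn4_sqr i : sgn4 i * sgn4 i = 1.
Proof. by rewrite -expr2 sqrr_sign. Qed.

(* [Sigma] is the tensor square of the adjugate involution [conj2]; [Bmx] is the
   (symmetric) tensor square of the symplectic matrix defining [conj2]. *)
Definition Bmx : 'M[R]_4 := \matrix_(i, j) (sgn4 i *+ (j == rev_ord i)).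
Definition Sigma (X : 'M[R]_4) := Bmx *m X^T *m Bmx.

Lemma mul_Bmxl (X : 'M_4) i j : (Bmx *m X) i j = sgn4 i * X (rev_ord i) j.
Proof.
rewrite mxE (bigD1 (rev_ord i)) //= big1 ?addr0 => [|w nw]; first by rewrite mxE eqxx.
by rewrite !mxE (negPf nw) mul0r.
Qed.

Lemma Bmx_tr : Bmx^T = Bmx.
Proof.
apply/matrixP=> i j; rewrite !mxE -(inj_eq rev_ord_inj) rev_ordK eq_sym.
by case: eqP => [->|//]; rewrite sgn4_rev.
Qed.

Lemma SigmaE (X : 'M_4) i j : Sigma X i j = sgn4 i * sgn4 j * X (rev_ord j) (rev_ord i).
Proof.
rewrite /Sigma -mulmxA mul_Bmxl -[X in X^T *m _]trmxK -[Bmx in X in _ * X]Bmx_tr.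
by rewrite -trmx_mul mxE trmxK mul_Bmxl mulrA.
Qed.

Lemma Bmx_sqr : Bmx *m Bmx = 1%:M.
Proof.
apply/matrixP=> i j; rewrite mul_Bmxl !mxE rev_ordK eq_sym sgn4_rev.
by rewrite mulrnAr sgn4_sqr.
Qed.

Lemma Sigma_mul X Y : Sigma (X *m Y) = Sigma Y *m Sigma X.
Proof.
by rewrite /Sigma trmx_mul !mulmxA -[_ *m Bmx *m Bmx]mulmxA Bmx_sqr mulmx1.
Qed.

Lemma Sigma_kron X Y : Sigma (kron X Y) = kron (conj2 X) (conj2 Y).
Proof.
apply/matrixP=> i j; rewrite SigmaE !mxE.
have rh (w : 'I_4) : hi_bit (rev_ord w) = rev_ord (hi_bit w).
  by apply: val_inj; case: w => [[|[|[|[|]]]]] //= ?; rewrite !inordK.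
have rl (w : 'I_4) : lo_bit (rev_ord w) = rev_ord (lo_bit w).
  by apply: val_inj; case: w => [[|[|[|[|]]]]] //= ?; rewrite !inordK.
rewrite !rh !rl [RHS]mulrACA; congr (_ * _).
case: i j => [[|[|[|[|]]]]] // ? [[|[|[|[|]]]]] // ?;
by rewrite /sgn4 -!val_eqE /= !inordK //= ?mulr1 ?mul1r ?mulrNN ?mulr1.
Qed.

End Kronecker.

(** * Pfaffians of 4 x 4 matrices *)

Lemma sum_inord4 (V : nmodType) (F : 'I_4 -> V) :
  \sum_(i < 4) F i = F (inord 0) + F (inord 1) + F (inord 2) + F (inord 3).
Proof.
rewrite !big_ord_recl big_ord0 addr0 !addrA.
by congr (_ + _ + _ + _); congr F; apply: val_inj; rewrite /= ?inordK.
Qed.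

Section Pfaffian.
Variable R : comPzRingType.
Implicit Types A g : 'M[R]_4.

(** With entries given by a function on natural numbers, the indices left after deleting rows and
    columns reduce by computation. *)
Lemma det3_fun (F : nat -> nat -> R) :
  \det (\matrix_(i < 3, j < 3) F i j) =
  F 0%N 0%N * (F 1%N 1%N * F 2%N 2%N - F 1%N 2%N * F 2%N 1%N)
  - F 0%N 1%N * (F 1%N 0%N * F 2%N 2%N - F 1%N 2%N * F 2%N 0%N)
  + F 0%N 2%N * (F 1%N 0%N * F 2%N 1%N - F 1%N 1%N * F 2%N 0%N).
Proof.
rewrite (expand_det_row _ ord0) !big_ord_recl big_ord0 /cofactor.
rewrite !(expand_det_row _ ord0) !big_ord_recl !big_ord0 /cofactor !det_mx11 !mxE /=.
by rewrite /bump /=; ring.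
Qed.

Lemma det4_fun (F : nat -> nat -> R) :
  let m i j := F 2%N i * F 3%N j - F 2%N j * F 3%N i in
  \det (\matrix_(i < 4, j < 4) F i j) =
  F 0%N 0%N * (F 1%N 1%N * m 2%N 3%N - F 1%N 2%N * m 1%N 3%N + F 1%N 3%N * m 1%N 2%N)
  - F 0%N 1%N * (F 1%N 0%N * m 2%N 3%N - F 1%N 2%N * m 0%N 3%N + F 1%N 3%N * m 0%N 2%N)
  + F 0%N 2%N * (F 1%N 0%N * m 1%N 3%N - F 1%N 1%N * m 0%N 3%N + F 1%N 3%N * m 0%N 1%N)
  - F 0%N 3%N * (F 1%N 0%N * m 1%N 2%N - F 1%N 1%N * m 0%N 2%N + F 1%N 2%N * m 0%N 1%N).
Proof.
move=> m; rewrite (expand_det_row _ ord0) !big_ord_recl big_ord0 /cofactor.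
pose G (j : 'I_4) (i l : nat) := F i.+1 (bump j l).
have E (j : 'I_4) : \det (row' ord0 (col' j (\matrix_(i < 4, j < 4) F i j))) =
    \det (\matrix_(i < 3, l < 3) G j i l).
  by congr (\det _); apply/matrixP=> i l; rewrite !mxE.
rewrite !E !det3_fun !mxE /= /G /bump /= /m; ring.
Qed.

Definition entry4 A i j : R := A (inord i) (inord j).

Lemma entry4_matrix A : A = \matrix_(i < 4, j < 4) entry4 A i j.
Proof. by apply/matrixP=> i j; rewrite mxE /entry4 !inord_val. Qed.

Definition pf A : R :=
  entry4 A 0 1 * entry4 A 2 3 - entry4 A 0 2 * entry4 A 1 3 + entry4 A 0 3 * entry4 A 1 2.

Definition alternating A := (forall i, A i i = 0) /\ A^T = - A.

Lemma alternating_entry4 A i j : alternating A -> entry4 A i j = - entry4 A j i.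
Proof. by case=> _ /matrixP/(_ (inord j) (inord i)); rewrite !mxE. Qed.

Lemma pf_sqr A : alternating A -> \det A = pf A ^+ 2.
Proof.
move=> altA; have [A0 _] := altA; rewrite [A in LHS]entry4_matrix det4_fun /pf.
rewrite (alternating_entry4 1 0 altA) (alternating_entry4 2 0 altA) (alternating_entry4 3 0 altA).
rewrite (alternating_entry4 2 1 altA) (alternating_entry4 3 1 altA) (alternating_entry4 3 2 altA).
by rewrite /entry4 !A0; ring.
Qed.

Lemma pf_congr A g : alternating A -> pf (g *m A *m g^T) = \det g * pf A.
Proof.
move=> altA; have [A0 _] := altA; rewrite [g in \det g]entry4_matrix det4_fun /pf.
(* Each entry is a combination of 2 x 2 minors of rows [i] and [j] of [g]. The final identity then
   amounts to the Laplace expansion of the determinant along two rows, together with the Plücker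
   relations. *)
have E i j : entry4 (g *m A *m g^T) i j =
    entry4 A 0 1 * (entry4 g i 0 * entry4 g j 1 - entry4 g i 1 * entry4 g j 0)
  + entry4 A 0 2 * (entry4 g i 0 * entry4 g j 2 - entry4 g i 2 * entry4 g j 0)
  + entry4 A 0 3 * (entry4 g i 0 * entry4 g j 3 - entry4 g i 3 * entry4 g j 0)
  + entry4 A 1 2 * (entry4 g i 1 * entry4 g j 2 - entry4 g i 2 * entry4 g j 1)
  + entry4 A 1 3 * (entry4 g i 1 * entry4 g j 3 - entry4 g i 3 * entry4 g j 1)
  + entry4 A 2 3 * (entry4 g i 2 * entry4 g j 3 - entry4 g i 3 * entry4 g j 2).
  rewrite {1}/entry4 !mxE sum_inord4 !mxE !sum_inord4 -!/(entry4 _ _ _).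
  rewrite (alternating_entry4 1 0 altA) (alternating_entry4 2 0 altA) (alternating_entry4 3 0 altA).
  rewrite (alternating_entry4 2 1 altA) (alternating_entry4 3 1 altA) (alternating_entry4 3 2 altA).
  by rewrite /entry4 !A0; ring.
rewrite !E; move: (entry4 A 0 1) (entry4 A 0 2) (entry4 A 0 3) (entry4 A 1 2) (entry4 A 1 3) (entry4 A 2 3).
move=> a b c d e f; ring.
Qed.

End Pfaffian.

(** * Split biquaternion algebras *)

Definition pxor (p r : 'I_4) : 'I_4 := inord (qidx p r).

Lemma val_pxor p r : pxor p r = qidx p r :> nat.
Proof. by rewrite inordK //; case: p r => [[|[|[|[|]]]]] // ? [[|[|[|[|]]]]]. Qed.

Section Splitting.
Variables (L : fieldType) (al b ga d : L).

(** The standard representation of the quaternion algebra of e^2 and b': i goes to diag(e, -e), and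
    j to the matrix with rows 0, b' and 1, 0. *)
Definition quat_mx (e b' : L) (p : 'I_4) : 'M[L]_2 :=
  \matrix_(i, j) ((if qb0 p then (-1) ^+ i * e else 1) *
    (if qb1 p then (if i == 0 then b' else 1) *+ (i != j) else (i == j)%:R)).

Lemma quat_mx_mul e b' p r :
  quat_mx e b' p *m quat_mx e b' r = qcoef (e ^+ 2) b' p r *: quat_mx e b' (pxor p r).
Proof.
apply/matrixP=> i j; rewrite !mxE !big_ord_recl big_ord0 !mxE /qb0 /qb1 !val_pxor /qidx /qcoef.
case: p r => [[|[|[|[|]]]]] // ? [[|[|[|[|]]]]] // ?; rewrite /qb0 /qb1 /=;
  case: i j => [[|[|]]] // ? [[|[|]]] // ?; rewrite -?val_eqE /= ?mulr1n ?mulr0n; ring.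
Qed.

Lemma quat_mx_tr e b' p : \tr (quat_mx e b' p) = if p == 0 then 2%:R else 0.
Proof.
rewrite /mxtrace !big_ord_recl big_ord0 !mxE.
by case: p => [[|[|[|[|]]]]] // ?; rewrite /qb0 /qb1 -?val_eqE /= ?mulr1n ?mulr0n; ring.
Qed.

Lemma quat_mx_conj e b' p : conj2 (quat_mx e b' p) = qeps L p *: quat_mx e b' p.
Proof.
apply/matrixP=> i j; rewrite !mxE /qeps.
case: p => [[|[|[|[|]]]]] // ?; rewrite /qb0 /qb1 /=;
  case: i j => [[|[|]]] // ? [[|[|]]] // ?; rewrite -?val_eqE /= ?mulr1n ?mulr0n; ring.
Qed.

Definition biquat_mx (x : 'M[L]_4) : 'M[L]_4 :=
  \sum_p \sum_q x p q *: kron (quat_mx al b p) (quat_mx ga d q).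

Lemma biquat_mx_lin c x y : biquat_mx (c *: x + y) = c *: biquat_mx x + biquat_mx y.
Proof.
rewrite /biquat_mx scaler_sumr -big_split; apply: eq_bigr => p _ /=.
rewrite scaler_sumr -big_split; apply: eq_bigr => q _ /=.
by rewrite !mxE scalerDl scalerA.
Qed.

Lemma biquat_mx_mul x y :
  biquat_mx (bq_mul (al ^+ 2) b (ga ^+ 2) d x y) = biquat_mx x *m biquat_mx y.
Proof.
transitivity (\sum_p \sum_q \sum_r \sum_w
  (qcoef (al ^+ 2) b p r * qcoef (ga ^+ 2) d q w * x p q * y r w) *:
    kron (quat_mx al b (pxor p r)) (quat_mx ga d (pxor q w))).
  rewrite /biquat_mx.
  under eq_bigr => s _ do under eq_bigr => t _ do
    (rewrite mxE scaler_suml; under eq_bigr => p _ do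
      (rewrite scaler_suml; under eq_bigr => q _ do
        (rewrite scaler_suml; under eq_bigr => r _ do rewrite scaler_suml))).
  under eq_bigr => s _ do rewrite exchange_big.
  rewrite exchange_big; apply: eq_bigr => p _ /=.
  under eq_bigr => s _ do rewrite exchange_big.
  rewrite exchange_big; apply: eq_bigr => q _ /=.
  under eq_bigr => s _ do rewrite exchange_big.
  rewrite exchange_big; apply: eq_bigr => r _ /=.
  under eq_bigr => s _ do rewrite exchange_big.
  rewrite exchange_big; apply: eq_bigr => w _ /=.
  (* A product of basis elements is a multiple of a single basis element, so for fixed [p], [q],
     [r], [w] only one pair of output indices survives. *)
  rewrite (bigD1 (pxor p r)) //= (bigD1 (pxor q w)) //= !val_pxor !eqxx /=.
  rewrite big1 ?addr0 => [|t nt]; last first.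
    by rewrite -(inj_eq val_inj) /= val_pxor in nt; rewrite [_ == nat_of_ord t]eq_sym (negPf nt) scale0r.
  rewrite big1 ?addr0 // => s ns; apply: big1 => t _.
  by rewrite -(inj_eq val_inj) /= val_pxor in ns; rewrite [_ == nat_of_ord s]eq_sym (negPf ns) scale0r.
rewrite /biquat_mx mulmx_suml; apply: eq_bigr => p _; rewrite mulmx_suml; apply: eq_bigr => q _.
rewrite mulmx_sumr; apply: eq_bigr => r _; rewrite mulmx_sumr; apply: eq_bigr => w _.
rewrite -scalemxAl -scalemxAr scalerA kron_mul !quat_mx_mul kronZl kronZr !scalerA.
by congr (_ *: _); ring.
Qed.

Lemma Sigma_lin c (X Y : 'M[L]_4) : Sigma (c *: X + Y) = c *: Sigma X + Sigma Y.
Proof. by apply/matrixP=> i j; rewrite !(SigmaE, mxE) mulrDr mulrCA. Qed.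

Lemma Sigma0 : Sigma (0 : 'M[L]_4) = 0.
Proof. by apply/matrixP=> i j; rewrite !(SigmaE, mxE) mulr0. Qed.

Lemma Sigma_sum (I : finType) (F : I -> 'M[L]_4) :
  Sigma (\sum_i F i) = \sum_i Sigma (F i).
Proof.
apply: (big_morph _ _ Sigma0) => X Y.
by rewrite -[X]scale1r Sigma_lin !scale1r.
Qed.

Lemma biquat_mx_sigma x : Sigma (biquat_mx x) = biquat_mx (bq_sigma x).
Proof.
rewrite /biquat_mx Sigma_sum; apply: eq_bigr => p _; rewrite Sigma_sum; apply: eq_bigr => q _.
rewrite -[_ *: kron _ _]addr0 Sigma_lin Sigma0 addr0 Sigma_kron !quat_mx_conj kronZl kronZr !scalerA mxE.
by congr (_ *: _); ring.
Qed.

Hypotheses (n2 : 2%:R != 0 :> L) (al0 : al != 0) (b0 : b != 0) (ga0 : ga != 0) (d0 : d != 0).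

Lemma quat_mx_tr_mul e b' p r :
  \tr (quat_mx e b' p *m quat_mx e b' r) = if p == r then qcoef (e ^+ 2) b' p p * 2%:R else 0.
Proof.
rewrite quat_mx_mul mxtraceZ quat_mx_tr -(inj_eq val_inj) /= val_pxor.
have -> : (qidx p r == 0%N) = (p == r).
  by rewrite -val_eqE; case: p r => [[|[|[|[|]]]]] // ? [[|[|[|[|]]]]].
by case: eqP => [->|]; rewrite ?mulr0.
Qed.

Lemma qcoef_neq0 a' b' p : a' != 0 -> b' != 0 -> qcoef a' b' p p != 0 :> L.
Proof.
move=> a0 b'0; rewrite /qcoef !mulf_neq0 ?signr_eq0 //.
  by case: ifP; rewrite ?oner_eq0.
by case: ifP; rewrite ?oner_eq0.
Qed.

(** The 16 basis elements are orthogonal for the trace form, and each pairs with itself to a nonzero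
    scalar; tracing against one of them isolates its coefficient. *)
Lemma biquat_mx_eq0 x : biquat_mx x = 0 -> x = 0.
Proof.
move=> x0; apply/matrixP=> r w; rewrite mxE; apply/eqP.
have: \tr (biquat_mx x *m kron (quat_mx al b r) (quat_mx ga d w)) = 0 by rewrite x0 mul0mx mxtrace0.
rewrite mulmx_suml raddf_sum (bigD1 r) //= mulmx_suml raddf_sum (bigD1 w) //=.
rewrite -scalemxAl mxtraceZ kron_mul kron_tr !quat_mx_tr_mul !eqxx.
rewrite big1 ?addr0 => [|q nq]; last first.
  by rewrite -scalemxAl mxtraceZ kron_mul kron_tr !quat_mx_tr_mul (negPf nq) !mulr0.
rewrite big1 ?addr0 => [|p np]; last first.
  rewrite mulmx_suml raddf_sum big1 // => q _ /=.
  by rewrite -scalemxAl mxtraceZ kron_mul kron_tr !quat_mx_tr_mul (negPf np) mul0r mulr0.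
have nz : qcoef (al ^+ 2) b r r * 2%:R * (qcoef (ga ^+ 2) d w w * 2%:R) != 0.
  by do 2![apply: mulf_neq0 => //]; apply: qcoef_neq0; rewrite ?expf_neq0.
by move/eqP; rewrite mulf_eq0 (negPf nz) orbF.
Qed.

End Splitting.

(** * Characteristic polynomial of left multiplication *)

Lemma char_poly_block (R : comNzRingType) (m n : nat) (A : 'M[R]_m) (B : 'M[R]_n) :
  char_poly (block_mx A 0 0 B) = char_poly A * char_poly B.
Proof.
rewrite /char_poly /char_poly_mx -(det_ublock _ 0); congr (\det _).
by rewrite map_block_mx !map_mx0 (scalar_mx_block m n 'X) opp_block_mx add_block_mx !oppr0 !addr0.
Qed.

Lemma char_poly_tr (R : comNzRingType) (n : nat) (A : 'M[R]_n) :
  char_poly A^T = char_poly A.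
Proof.
rewrite /char_poly /char_poly_mx -det_tr; congr (\det _).
by rewrite raddfB /= tr_scalar_mx -map_trmx trmxK.
Qed.

Lemma char_poly_intertwine (F : fieldType) (m n : nat)
    (A : 'M[F]_m) (D : 'M_n) (T : 'M_(m, n)) :
  m = n -> row_free T -> A *m T = T *m D -> char_poly A = char_poly D.
Proof.
move=> emn; case: n / emn D T => D T.
rewrite row_free_unit unitmxE unitfE => dT eAD; pose T' := map_mx polyC T.
have dT' : \det T' != 0 by rewrite det_map_mx polyC_eq0.
apply: (mulIf dT'); rewrite /char_poly -det_mulmx mulrC -det_mulmx; congr (\det _).
by rewrite /char_poly_mx mulmxBl mulmxBr -!map_mxM eAD mul_scalar_mx mul_mx_scalar.
Qed.

Section LeftMultiplication.
Variables (L : fieldType) (al b ga d : L).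
Hypotheses (n2 : 2%:R != 0 :> L) (al0 : al != 0) (b0 : b != 0) (ga0 : ga != 0) (d0 : d != 0).

Local Notation rho := (biquat_mx al b ga d).

(** Flattening by columns: left multiplication acts on each column separately, so it becomes four
    diagonal blocks, transposed because matrices act on row vectors. *)
Definition cols_row (X : 'M[L]_4) : 'rV_(4 + (4 + (4 + 4))) :=
  row_mx (row 0 X^T) (row_mx (row 1 X^T) (row_mx (row (inord 2) X^T) (row (inord 3) X^T))).

Definition block_diag4 (N : 'M[L]_4) : 'M_(4 + (4 + (4 + 4))) :=
  block_mx N 0 0 (block_mx N 0 0 (block_mx N 0 0 N)).

Lemma cols_row_mul A X : cols_row (A *m X) = cols_row X *m block_diag4 A^T.
Proof.
rewrite /cols_row /block_diag4 !mul_row_block !(mulmx0, add0r, addr0).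
by rewrite trmx_mul !row_mul.
Qed.

Lemma cols_row_lin c X Y : cols_row (c *: X + Y) = c *: cols_row X + cols_row Y.
Proof.
have E i : row i (c *: X + Y)^T = c *: row i X^T + row i Y^T.
  by apply/rowP=> j; rewrite !mxE.
by rewrite /cols_row !E !scale_row_mx !add_row_mx.
Qed.

Lemma cols_row_eq0 X : cols_row X = 0 -> X = 0.
Proof.
rewrite /cols_row => e.
have := congr1 lsubmx e; rewrite row_mxKl raddf0 => r0.
have := congr1 rsubmx e; rewrite row_mxKr raddf0 => {}e.
have := congr1 lsubmx e; rewrite row_mxKl raddf0 => r1.
have := congr1 rsubmx e; rewrite row_mxKr raddf0 => {}e.
have := congr1 lsubmx e; rewrite row_mxKl raddf0 => r2.
have := congr1 rsubmx e; rewrite row_mxKr raddf0 => r3.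
apply: trmx_inj; apply/row_matrixP=> i; rewrite trmx0 row0.
have [->//|->//|->//|->//] : [\/ i = 0, i = 1, i = inord 2 | i = inord 3].
by case: i => [[|[|[|[|]]]]] // ?; [constructor 1|constructor 2|constructor 3|constructor 4];
  apply: val_inj; rewrite /= ?inordK.
Qed.

Definition split_mx : 'M[L]_(4 * 4, 4 + (4 + (4 + 4))) :=
  \matrix_e cols_row (rho (vec_mx (delta_mx 0 e))).

Lemma mul_split_mx w : w *m split_mx = cols_row (rho (vec_mx w)).
Proof.
pose h (v : 'rV[L]_(4 * 4)) := cols_row (rho (vec_mx v)).
have hl c x y : h (c *: x + y) = c *: h x + h y.
  by rewrite /h [vec_mx _]linearP biquat_mx_lin cols_row_lin.
have h0 : h 0 = 0 by apply: (addrI (h 0)); rewrite addr0 -{1}[h 0]scale1r -hl scale1r addr0.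
rewrite mulmx_sum_row -/(h w) {2}[w]row_sum_delta.
elim/big_rec2: _ => [|e x y _ ->]; first by rewrite h0.
by rewrite hl rowK.
Qed.

Lemma split_mx_intertwine u :
  bq_Lmat (al ^+ 2) b (ga ^+ 2) d u *m split_mx = split_mx *m block_diag4 (rho u)^T.
Proof.
apply/row_matrixP=> e; rewrite !row_mul rowK.
have -> : row e (bq_Lmat (al ^+ 2) b (ga ^+ 2) d u) =
    mxvec (bq_mul (al ^+ 2) b (ga ^+ 2) d u (vec_mx (delta_mx 0 e))).
  by apply/rowP=> j; rewrite !mxE.
by rewrite mul_split_mx mxvecK biquat_mx_mul cols_row_mul.
Qed.

(** The matrix algebra, as a left module over itself, is four copies of the column space; [split_mx]
    is the resulting change of basis. *)
Lemma char_poly_bq_Lmat u :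
  char_poly (bq_Lmat (al ^+ 2) b (ga ^+ 2) d u) = char_poly (rho u) ^+ 4.
Proof.
have uT : row_free split_mx.
  rewrite -kermx_eq0; apply/rowV0P=> w /sub_kermxP.
  by rewrite mul_split_mx => /cols_row_eq0/(biquat_mx_eq0 n2 al0 b0 ga0 d0)/eqP; rewrite vec_mx_eq0 => /eqP.
transitivity (char_poly (block_diag4 (rho u)^T)); last first.
  by rewrite /block_diag4 !char_poly_block char_poly_tr; ring.
exact: char_poly_intertwine erefl uT (split_mx_intertwine u).
Qed.

End LeftMultiplication.

(** * Skew elements and the Albert form *)

Section SkewSpace.
Variables (k L : fieldType) (f : {rmorphism k -> L}) (a b c d iota : k) (al ga : L).
Hypotheses (n2 : 2%:R != 0 :> k) (a0 : a != 0) (b0 : b != 0) (c0 : c != 0) (d0 : d != 0).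
Hypotheses (al2 : al ^+ 2 = f a) (ga2 : ga ^+ 2 = f c) (iota_sqr : iota ^+ 2 = -1).

Definition biquat_rep (u : 'M[k]_4) : 'M[L]_4 := biquat_mx al (f b) ga (f d) (map_mx f u).

Lemma two_neq0_ext : 2%:R != 0 :> L.
Proof. by rewrite -(rmorph_nat f) fmorph_eq0. Qed.

Lemma map_iota_sqr : f iota ^+ 2 = -1.
Proof. by rewrite -rmorphXn iota_sqr rmorphN1. Qed.

Lemma al_neq0 : al != 0.
Proof. by apply: contraNneq a0 => e0; rewrite -(fmorph_eq0 f) -al2 e0 expr0n. Qed.

Lemma ga_neq0 : ga != 0.
Proof. by apply: contraNneq c0 => e0; rewrite -(fmorph_eq0 f) -ga2 e0 expr0n. Qed.

Lemma map_qcoef a' b' p r : f (qcoef a' b' p r) = qcoef (f a') (f b') p r.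
Proof.
rewrite /qcoef !rmorphM /= rmorph_sign.
by do 2![case: ifP => _]; rewrite ?rmorph1.
Qed.

Lemma map_bq_mul u v : map_mx f (bq_mul a b c d u v) =
  bq_mul (f a) (f b) (f c) (f d) (map_mx f u) (map_mx f v).
Proof.
apply/matrixP=> s t; rewrite !mxE; do 4![rewrite rmorph_sum; apply: eq_bigr => ? _ /=].
by case: ifP => _; rewrite ?rmorph0 // 3!rmorphM /= !map_qcoef !mxE.
Qed.

Lemma biquat_rep_mul u v : biquat_rep (bq_mul a b c d u v) = biquat_rep u *m biquat_rep v.
Proof. by rewrite /biquat_rep map_bq_mul -al2 -ga2 biquat_mx_mul. Qed.

Lemma biquat_rep_sigma u : biquat_rep (bq_sigma u) = Sigma (biquat_rep u).
Proof.
rewrite /biquat_rep biquat_mx_sigma; congr biquat_mx; apply/matrixP=> i j; rewrite !mxE /qeps !rmorphM /=.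
by do 2![case: ifP => _]; rewrite ?rmorphN ?rmorph1.
Qed.

Lemma biquat_rep_lin x u v : biquat_rep (x *: u + v) = f x *: biquat_rep u + biquat_rep v.
Proof. by rewrite /biquat_rep map_mxD map_mxZ biquat_mx_lin. Qed.

Lemma biquat_rep0 : biquat_rep 0 = 0.
Proof. by have := biquat_rep_lin (-1) 0 0; rewrite scaler0 addr0 rmorphN1 scaleN1r addNr. Qed.

Lemma biquat_repN u : biquat_rep (- u) = - biquat_rep u.
Proof. by rewrite -[- u]addr0 -scaleN1r biquat_rep_lin biquat_rep0 addr0 rmorphN1 scaleN1r. Qed.

Lemma biquat_rep_eq0 u : biquat_rep u = 0 -> u = 0.
Proof.
move=> e; apply/eqP; rewrite -(map_mx_eq0 f); apply/eqP.
by apply: (biquat_mx_eq0 two_neq0_ext al_neq0 _ ga_neq0) e; rewrite fmorph_eq0.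
Qed.

Lemma biquat_rep_inj : injective biquat_rep.
Proof.
move=> u v e; apply/eqP; rewrite -subr_eq0; apply/eqP/biquat_rep_eq0.
by rewrite -[u]scale1r biquat_rep_lin rmorph1 scale1r biquat_repN e subrr.
Qed.

Lemma map_char_poly_Lmat u :
  map_poly f (char_poly (bq_Lmat a b c d u)) = char_poly (biquat_rep u) ^+ 4.
Proof.
rewrite -(char_poly_bq_Lmat two_neq0_ext al_neq0 _ ga_neq0) ?fmorph_eq0 // al2 ga2 map_char_poly.
congr char_poly; apply: map_lin_mx => v; exact: map_bq_mul.
Qed.

Definition coord (x : 'rV[k]_6) (i : nat) : k := x 0 (inord i).

(* The factors [iota] turn [<a, b, -ab, -c, -d, cd>], the form [s * s~] in the
   standard basis of the skew elements, into [<a, b, ab, c, d, cd>]. *)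
Definition skew_vec (x : 'rV[k]_6) : 'M[k]_4 := \matrix_(p, q)
  (if q == 0%N :> nat
   then nth 0 [:: 0; coord x 0; coord x 1; iota * coord x 2] p
   else if p == 0%N :> nat
   then nth 0 [:: 0; iota * coord x 3; iota * coord x 4; coord x 5] q else 0).

Definition skew_mx x := biquat_rep (skew_vec x).

Definition tilde (x : 'rV[k]_6) : 'rV[k]_6 := \row_i (if (i < 3)%N then x 0 i else - x 0 i).

Definition albert (x y : 'rV[k]_6) : k :=
  a * (coord x 0 * coord y 0) + b * (coord x 1 * coord y 1) + a * b * (coord x 2 * coord y 2)
  + (c * (coord x 3 * coord y 3) + d * (coord x 4 * coord y 4) + c * d * (coord x 5 * coord y 5)).

Lemma skew_mx_lin t x y : skew_mx (t *: x + y) = f t *: skew_mx x + skew_mx y.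
Proof.
rewrite /skew_mx -biquat_rep_lin; congr biquat_rep; apply/matrixP=> p q; rewrite !mxE /coord !mxE.
case: p q => [[|[|[|[|]]]]] // ? [[|[|[|[|]]]]] // ?; rewrite /=; ring.
Qed.

Lemma tildeK : involutive tilde.
Proof. by move=> x; apply/rowP=> i; rewrite /tilde !mxE; case: (i < 3)%N => //; rewrite opprK. Qed.

Lemma coord_tilde x i : (i < 6)%N ->
  coord (tilde x) i = if (i < 3)%N then coord x i else - coord x i.
Proof. by move=> lti; rewrite /coord mxE inordK. Qed.

Lemma albert_tilde x y : albert (tilde x) (tilde y) = albert x y.
Proof. by rewrite /albert !coord_tilde //=; ring. Qed.

Lemma albertC x y : albert x y = albert y x.
Proof. by rewrite /albert; ring. Qed.

(** The image under [quat_mx] of the pure quaternion x i + y j + z ij. *)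
Definition pure_quat_mx (e b' x y z : L) : 'M[L]_2 :=
  \matrix_(i, j) (if i == 0 then if j == 0 then e * x else b' * (y + e * z)
                  else if j == 0 then y - e * z else - (e * x)).

Lemma pure_quat_mx_sqr e b' x y z :
  pure_quat_mx e b' x y z *m pure_quat_mx e b' x y z =
  (e ^+ 2 * x ^+ 2 + b' * y ^+ 2 - e ^+ 2 * b' * z ^+ 2)%:M.
Proof.
apply/matrixP=> i j; rewrite !mxE !big_ord_recl big_ord0 !mxE.
by case: i j => [[|[|]]] // ? [[|[|]]] // ?; rewrite -!val_eqE /= ?mulr1n ?mulr0n; ring.
Qed.

Lemma pure_quat_mxN e b' x y z :
  pure_quat_mx e b' (- x) (- y) (- z) = - pure_quat_mx e b' x y z.
Proof.
by apply/matrixP=> i j; rewrite !mxE; do 2![case: ifP => _]; ring.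
Qed.

Lemma skew_mx_kron x : skew_mx x =
  kron (pure_quat_mx al (f b) (f (coord x 0)) (f (coord x 1)) (f iota * f (coord x 2))) 1%:M
  + kron 1%:M (pure_quat_mx ga (f d) (f iota * f (coord x 3)) (f iota * f (coord x 4)) (f (coord x 5))).
Proof.
rewrite /skew_mx /biquat_rep /biquat_mx !sum_inord4 !mxE !inordK //=.
rewrite !rmorph0 !scale0r !(add0r, addr0).
apply/matrixP=> i j; rewrite !mxE !rmorphM.
move: (hi_bit i) (hi_bit j) (lo_bit i) (lo_bit j) => hi hj li lj; rewrite /qb0 /qb1 !inordK //=.
case: hi hj => [[|[|]]] // ? [[|[|]]] // ?; case: li lj => [[|[|]]] // ? [[|[|]]] // ?;
rewrite -!val_eqE /= ?mulr1n ?mulr0n; ring.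
Qed.

Lemma kron_scalar_l (s : L) : kron s%:M 1%:M = s%:M.
Proof.
apply/matrixP=> i j; rewrite !mxE.
case: i j => [[|[|[|[|]]]]] // ? [[|[|[|[|]]]]] // ?;
by rewrite -!val_eqE /= !inordK //= ?mulr1n ?mulr0n; ring.
Qed.

Lemma kron_scalar_r (s : L) : kron 1%:M s%:M = s%:M.
Proof.
apply/matrixP=> i j; rewrite !mxE.
case: i j => [[|[|[|[|]]]]] // ? [[|[|[|[|]]]]] // ?;
by rewrite -!val_eqE /= !inordK //= ?mulr1n ?mulr0n; ring.
Qed.

(** A skew element is the sum of pure quaternions X and Y from the two commuting factors, and (X +
    Y)(X - Y) = X^2 - Y^2 is scalar. *)
Lemma skew_mx_sqr x : skew_mx x *m skew_mx (tilde x) = (f (albert x x))%:M.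
Proof.
rewrite !skew_mx_kron !coord_tilde //= !rmorphN !mulrN pure_quat_mxN.
set X := pure_quat_mx al _ _ _ _; set Y := pure_quat_mx ga _ _ _ _.
have -> : kron 1%:M (- Y) = - kron 1%:M Y.
  by rewrite -[- Y]scaleN1r kronZr scaleN1r.
rewrite mulmxDl !mulmxBr !kron_mul !(mul1mx, mulmx1) addrA subrK !pure_quat_mx_sqr.
rewrite kron_scalar_l kron_scalar_r -raddfB /=; congr (_%:M).
rewrite al2 ga2 !exprMn map_iota_sqr /albert !(rmorphD, rmorphM) /=; ring.
Qed.

(** Polarization of the previous identity. For orthogonal s and t it is the rule s t~ = - t s~, on
    which both directions of the theorem rely. *)
Lemma skew_mx_polar x y :
  skew_mx x *m skew_mx (tilde y) + skew_mx y *m skew_mx (tilde x) = (f (2%:R * albert x y))%:M.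
Proof.
have tildeD : tilde (x + y) = tilde x + tilde y.
  by apply/rowP=> i; rewrite !mxE; case: ifP => _; rewrite ?opprD.
have SD u v : skew_mx (u + v) = skew_mx u + skew_mx v by rewrite -[u]scale1r skew_mx_lin rmorph1 !scale1r.
have := skew_mx_sqr (x + y); rewrite tildeD !SD mulmxDl !mulmxDr !skew_mx_sqr.
have -> : albert (x + y) (x + y) = albert x x + 2%:R * albert x y + albert y y.
  by rewrite /albert /coord !mxE; ring.
rewrite !rmorphD /= => /eqP; rewrite -addrA -[X in _ == X]addrA (inj_eq (addrI _)).
by rewrite addrA (inj_eq (addIr _)) => /eqP.
Qed.

Lemma Sigma_skew_mx x : Sigma (skew_mx x) = - skew_mx x.
Proof.
rewrite /skew_mx -biquat_rep_sigma; have -> : bq_sigma (skew_vec x) = - skew_vec x.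
  apply/matrixP=> p q; rewrite !mxE /qeps.
  case: p q => [[|[|[|[|]]]]] // ? [[|[|[|[|]]]]] // ?; rewrite /=; ring.
exact: biquat_repN.
Qed.

Lemma biquat_rep_skew w : Sigma (biquat_rep w) = - biquat_rep w ->
  exists x, biquat_rep w = skew_mx x.
Proof.
rewrite -biquat_rep_sigma => e.
have {}e : bq_sigma w = - w.
  by apply: biquat_rep_inj; rewrite e biquat_repN.
(* The inverse of [iota] is [- iota], which undoes the normalizing factors of [skew_vec]. *)
exists (\row_i nth 0 [:: w (inord 1) 0; w (inord 2) 0; - iota * w (inord 3) 0;
   - iota * w 0 (inord 1); - iota * w 0 (inord 2); w 0 (inord 3)] i).
congr biquat_rep; apply/matrixP=> p q; rewrite !mxE /coord !mxE !inordK //=.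
have io (x : k) : iota * (- iota * x) = x by rewrite mulrA mulrN -expr2 iota_sqr opprK mul1r.
move/matrixP/(_ p q): e; rewrite !mxE /qeps => e.
have z (x : k) : 1 * 1 * x = - x -> x = 0.
  by move/eqP; rewrite !mul1r -addr_eq0 -mulr2n -mulr_natl mulf_eq0 (negPf n2) => /eqP.
have z' (x : k) : -1 * -1 * x = - x -> x = 0 by rewrite mulrNN; apply: z.
case: p q e => [[|[|[|[|]]]]] // ? [[|[|[|[|]]]]] // ? /= e;
 by rewrite ?io ?(z _ e) ?(z' _ e) //; congr (w _ _); apply: val_inj; rewrite /= ?inordK.
Qed.

Lemma skew_mx_eq0 x : skew_mx x = 0 -> x = 0.
Proof.
move/biquat_rep_eq0/matrixP=> e.
have e1 (p q : nat) := e (inord p) (inord q).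
have i0 t : iota * t = 0 -> t = 0.
  move/eqP; rewrite mulf_eq0 => /orP[/eqP i0|/eqP//].
  by have := iota_sqr; rewrite i0 expr0n => /eqP; rewrite eq_sym oppr_eq0 oner_eq0.
have z (i : nat) : (i < 6)%N -> coord x i = 0.
  case: i => [|[|[|[|[|[|]]]]]] // _.
  - by have := e1 1%N 0%N; rewrite !mxE !inordK.
  - by have := e1 2%N 0%N; rewrite !mxE !inordK.
  - by have := e1 3%N 0%N; rewrite !mxE !inordK // => /i0.
  - by have := e1 0%N 1%N; rewrite !mxE !inordK // => /i0.
  - by have := e1 0%N 2%N; rewrite !mxE !inordK // => /i0.
  - by have := e1 0%N 3%N; rewrite !mxE !inordK.
by apply/rowP=> i; rewrite mxE -(z i (ltn_ord i)) /coord inord_val.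
Qed.

Lemma skew_mx_alternating x : alternating (Bmx L *m skew_mx x).
Proof.
have tr : (Bmx L *m skew_mx x)^T = - (Bmx L *m skew_mx x).
  rewrite -mulmxN -Sigma_skew_mx /Sigma !mulmxA Bmx_sqr mul1mx trmx_mul Bmx_tr //.
split=> // i; move/matrixP/(_ i i)/eqP: tr; rewrite mxE [X in _ == X]mxE.
by rewrite -addr_eq0 -mulr2n -mulr_natl mulf_eq0 (negPf two_neq0_ext) => /eqP.
Qed.

(** This identifies the Albert form with a Pfaffian. The minus sign is squared away in the
    determinant and occurs on both sides of the sandwich identity. *)
Lemma pf_skew_mx x : pf (Bmx L *m skew_mx x) = - f (albert x x).
Proof.
rewrite /pf /entry4 !mul_Bmxl skew_mx_kron !mxE.
have r0 (i : nat) : (i < 4)%N -> rev_ord (inord i : 'I_4) = inord (3 - i).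
  by move=> lti; apply: val_inj; rewrite /= !inordK // ?subSS //; lia.
have hE (i : nat) : (i < 4)%N -> hi_bit (inord i) = inord i./2 by move=> lti; rewrite /hi_bit inordK.
have lE (i : nat) : (i < 4)%N -> lo_bit (inord i) = inord (odd i) by move=> lti; rewrite /lo_bit inordK.
rewrite !r0 // /sgn4 !inordK // !hE // !lE //=.
have e00 : (inord 0 == 0 :> 'I_2) = true by rewrite -val_eqE /= inordK.
have e10 : (inord 1 == 0 :> 'I_2) = false by rewrite -val_eqE /= inordK.
have e01 : (inord 0 == inord 1 :> 'I_2) = false by rewrite -val_eqE /= !inordK.
have e11 : (inord 1 == inord 0 :> 'I_2) = false by rewrite -val_eqE /= !inordK.
rewrite !(e00, e10, e01, e11, eqxx) ?mulr1n ?mulr0n.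
rewrite /albert !(rmorphD, rmorphM) /= -al2 -ga2.
have := map_iota_sqr; move: (f iota) => j j2.
ring: j2.
Qed.

Lemma det_Bmx : \det (Bmx L) = 1.
Proof.
rewrite [Bmx L]entry4_matrix det4_fun /entry4 !mxE /sgn4 -!val_eqE /= !inordK //=; ring.
Qed.

Lemma det_skew_mx x : \det (skew_mx x) = f (albert x x) ^+ 2.
Proof.
by rewrite -[LHS]mul1r -det_Bmx -det_mulmx (pf_sqr (skew_mx_alternating x)) pf_skew_mx sqrrN.
Qed.

(** For symmetric [U] one has B U = U^T B, so B (U s U) = U^T (B s) U, and a Pfaffian is multiplied
    by the determinant under congruence. *)
Lemma albert_sandwich U x y : Sigma U = U -> U *m skew_mx x *m U = skew_mx y ->
  f (albert y y) = \det U * f (albert x x).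
Proof.
move=> sU eU; apply: oppr_inj; rewrite -mulrN -!pf_skew_mx -eU -(det_tr U).
rewrite -(pf_congr _ (skew_mx_alternating x)) trmxK !mulmxA; congr (pf (_ *m _ *m _)).
by rewrite -{1}sU /Sigma !mulmxA Bmx_sqr mul1mx.
Qed.

End SkewSpace.

(** * Symmetric elements and orthogonal triples *)

Section OrthogonalFamilies.
Variable k : fieldType.

Definition bform n (G : 'M[k]_n) (x y : 'rV_n) : k := (x *m G *m y^T) 0 0.

(** Fewer than [n] linear equations in [n] unknowns have a nonzero solution. *)
Lemma orthogonal_vector n (G : 'M[k]_n) (l : seq 'rV_n) : (size l < n)%N ->
  exists2 x, x != 0 & forall y, y \in l -> bform G x y = 0.
Proof.
move=> ltl; pose W : 'M_(size l, n) := \matrix_i l`_i.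
have : (0 < \rank (kermx (G *m W^T)))%N.
  by rewrite mxrank_ker subn_gt0 (leq_ltn_trans _ ltl) // (leq_trans (rank_leq_col _)).
rewrite lt0n mxrank_eq0 => /rowV0Pn[x /sub_kermxP xK x0]; exists x => // y /(nthP 0)[i lti <-].
have -> : bform G x l`_i = (x *m (G *m W^T)) 0 (Ordinal lti).
  rewrite mulmxA /bform !mxE; apply: eq_bigr => j _; by rewrite !mxE.
by rewrite xK mxE.
Qed.

Lemma congruent_orthogonal_basis (t : seq k) (l : seq 'rV[k]_(size t)) :
  size l = size t ->
  (forall i j, (i < size l)%N -> (j < size l)%N -> i != j -> bform (gram t) l`_i l`_j = 0) ->
  congruent [seq bform (gram t) x x | x <- l] t.
Proof.
move=> sl ol; exists (\matrix_i l`_i); split; first by rewrite size_map.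
apply/matrixP=> i j; have [lti ltj] : (i < size l)%N /\ (j < size l)%N.
  by split; rewrite -(size_map (fun x => bform (gram t) x x)) ltn_ord.
transitivity (bform (gram t) l`_i l`_j).
  rewrite /bform !mxE; apply: eq_bigr => w _; rewrite !mxE; congr (_ * _).
  by apply: eq_bigr => v _; rewrite !mxE.
rewrite !mxE (nth_map 0) //; have [->|ne] := eqVneq i j; first by rewrite mulr1n.
by rewrite ol.
Qed.

End OrthogonalFamilies.

Section Core.
Variables (k L : fieldType) (f : {rmorphism k -> L}) (a b c d iota : k) (al ga : L).
Hypotheses (n2 : 2%:R != 0 :> k) (a0 : a != 0) (b0 : b != 0) (c0 : c != 0) (d0 : d != 0).
Hypotheses (al2 : al ^+ 2 = f a) (ga2 : ga ^+ 2 = f c) (iota_sqr : iota ^+ 2 = -1).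

Local Notation biquat_rep := (biquat_rep f b d al ga).
Local Notation skew_mx := (skew_mx f b d iota al ga).
Local Notation albert := (albert a b c d).
Local Notation qA := [:: a; b; a * b; c; d; c * d].

Lemma albertE x y : albert x y = bform (gram qA) x y.
Proof.
rewrite /bform mxE; under eq_bigr => i _ do rewrite mul_mx_diag !mxE.
have -> F : \sum_(i < 6) F i = F (inord 0) + F (inord 1) + F (inord 2) + F (inord 3)
    + F (inord 4) + F (inord 5) :> k.
  rewrite !big_ord_recl big_ord0 addr0 !addrA.
  by congr (_ + _ + _ + _ + _ + _); congr F; apply: val_inj; rewrite /= ?inordK.
by rewrite /albert /coord !inordK //=; ring.
Qed.

Lemma scalar_mulC (X Y : 'M[L]_4) z : z != 0 -> X *m Y = z%:M -> Y *m X = z%:M.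
Proof.
move=> z0 e; have e1 : X *m (z^-1 *: Y) = 1%:M.
  by rewrite -scalemxAr e scale_scalar_mx mulVf.
move/mulmx1C: e1; rewrite -scalemxAl => e1.
by rewrite -[Y *m X]scale1r -(mulfV z0) -scalerA e1 scalemx1.
Qed.

Lemma skew_mx0 : skew_mx 0 = 0.
Proof.
have := skew_mx_lin f b d iota al ga (-1) 0 0.
by rewrite scaler0 addr0 rmorphN1 scaleN1r addNr.
Qed.

Lemma skew_mxZ t x : skew_mx (t *: x) = f t *: skew_mx x.
Proof. by rewrite -[t *: x]addr0 skew_mx_lin skew_mx0 addr0. Qed.

Lemma tilde_lin t (x y : 'rV[k]_6) : tilde (t *: x + y) = t *: tilde x + tilde y.
Proof. by apply/rowP=> i; rewrite !mxE; case: (i < 3)%N => //; ring. Qed.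

Lemma tilde0 : tilde 0 = 0 :> 'rV[k]_6.
Proof. by apply/rowP=> i; rewrite !mxE; case: (i < 3)%N; rewrite ?oppr0. Qed.

Lemma tildeZ t (x : 'rV[k]_6) : tilde (t *: x) = t *: tilde x.
Proof. by rewrite -[t *: x]addr0 tilde_lin tilde0 addr0. Qed.

Lemma skew_mx_anticomm x y : albert x y = 0 ->
  skew_mx x *m skew_mx (tilde y) = - (skew_mx y *m skew_mx (tilde x)).
Proof.
move=> xy; apply/eqP; rewrite -addr_eq0 (skew_mx_polar _ _ al2 ga2 iota_sqr) xy mulr0 rmorph0.
by rewrite raddf0.
Qed.

Lemma skew_mx_sqr_tilde x : skew_mx (tilde x) *m skew_mx x = (f (albert x x))%:M.
Proof. by rewrite -{2}[x]tildeK (skew_mx_sqr _ _ al2 ga2 iota_sqr) albert_tilde. Qed.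

Lemma skew_mx_anticomm_tilde x y : albert x y = 0 ->
  skew_mx (tilde x) *m skew_mx y = - (skew_mx (tilde y) *m skew_mx x).
Proof. by move=> xy; rewrite -{1}[y]tildeK skew_mx_anticomm ?albert_tilde // tildeK. Qed.

Lemma symmetric_of_orthogonal_triple lam x y s1 s2 s3 : lam != 0 -> x != 0 -> y != 0 ->
  lam * albert s1 s1 = x -> lam * albert s2 s2 = y -> lam * albert s3 s3 = x * y ->
  albert s1 s2 = 0 -> albert s1 s3 = 0 -> albert s2 s3 = 0 ->
  exists u, bq_sigma u = u /\ \det (biquat_rep u) = f (lam ^+ 2).
Proof.
move=> l0 x0 y0 e1 e2 e3 o12 o13 o23.
(* The three skew factors have determinant (q1 q2 q3)^2 = (xy)^4 / lam^6, and a scalar enters the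
   determinant with its fourth power; this [ka] makes the total lam^2. *)
pose ka := lam ^+ 2 / (x * y).
exists (ka *: bq_mul a b c d (skew_vec iota (tilde s1))
          (bq_mul a b c d (skew_vec iota s2) (skew_vec iota (tilde s3)))).
set u := _ *: _; have rE : biquat_rep u = f ka *: (skew_mx (tilde s1) *m (skew_mx s2 *m skew_mx (tilde s3))).
  by rewrite /u -[_ *: _]addr0 biquat_rep_lin biquat_rep0 addr0 !biquat_rep_mul.
split.
  apply: (biquat_rep_inj n2 a0 b0 c0 d0 al2 ga2); rewrite biquat_rep_sigma rE.
  rewrite -[_ *: _]addr0 Sigma_lin Sigma0 addr0 !Sigma_mul !Sigma_skew_mx !(mulmxN, mulNmx) !opprK.
  (* The involution reverses the product and contributes three minus signs; undoing the reversal
     takes three anticommutations, whose signs cancel these. Alternating tildes put every adjacent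
     pair in the form to which the rule applies. *)
  have E : skew_mx (tilde s3) *m skew_mx s2 *m skew_mx (tilde s1) = - (skew_mx (tilde s1) *m (skew_mx s2 *m skew_mx (tilde s3))).
    have o32 : albert s3 s2 = 0 by rewrite albertC.
    have o31 : albert s3 s1 = 0 by rewrite albertC.
    have o21 : albert s2 s1 = 0 by rewrite albertC.
    rewrite (skew_mx_anticomm_tilde o32) mulNmx -mulmxA (skew_mx_anticomm o31) mulmxN opprK.
    by rewrite [LHS]mulmxA (skew_mx_anticomm_tilde o21) mulNmx mulmxA.
  by rewrite E opprK addr0.
rewrite rE detZ !det_mulmx !(det_skew_mx n2 a0 b0 c0 d0 al2 ga2 iota_sqr) !albert_tilde.
rewrite -!rmorphXn -!rmorphM /=; congr (f _).
have q1 : albert s1 s1 = x / lam by rewrite -e1 mulrAC mulfV // mul1r.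
have q2 : albert s2 s2 = y / lam by rewrite -e2 mulrAC mulfV // mul1r.
have q3 : albert s3 s3 = x * y / lam by rewrite -e3 mulrAC mulfV // mul1r.
by rewrite q1 q2 q3 /ka; field; rewrite l0 x0 y0.
Qed.

Lemma orthogonal_eigenvectors (n : nat) (M : 'M[k]_n) (G : 'M[k]_n) lam :
  (3 < n)%N -> lam != 0 -> M *m M = (lam ^+ 2)%:M ->
  exists eps s1 s2, [/\ eps = 1 \/ eps = -1, s1 != 0 & s2 != 0] /\
    [/\ s1 *m M = (eps * lam) *: s1, s2 *m M = (eps * lam) *: s2 & bform G s2 s1 = 0].
Proof.
move=> n3 l0 M2.
(* Since M^2 = lam^2, the image of M + e lam lies in the eigenspace for e lam. *)
have eig e r : e ^+ 2 = 1 -> let s := r *m (M + (e * lam)%:M) in s *m M = (e * lam) *: s :> 'rV_n.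
  move=> e2 /=; rewrite mulmxDr mulmxDl -mulmxA M2 !mul_mx_scalar scalerDr addrC -scalemxAl.
  by rewrite scalerA mulrACA -!expr2 e2 mul1r.
have [e [e1 rk]] : exists e, (e = 1 \/ e = -1) /\ (1 < \rank (M + (e * lam)%:M)%R)%N.
  have [lt|le] := ltnP 1 (\rank (M + (1 * lam)%:M)%R).
    by exists 1; split; [left|].
  exists (-1); split; first by right.
  (* The difference of the two maps is the invertible scalar 2 lam, so their ranks add up to at
     least [n], and they cannot both be at most 1. *)
  have e : (M + (1 * lam)%:M) - (M + (-1 * lam)%:M) = (2%:R * lam)%:M.
    by apply/matrixP=> i j; rewrite !mxE; case: (i == j); rewrite ?mulr1n ?mulr0n; ring.
  have := mxrank_add (M + (1 * lam)%:M)%R (- (M + (-1 * lam)%:M))%R.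
  rewrite e mxrank_opp mxrank_unit; last first.
    by rewrite unitmxE det_scalar unitrX // unitfE mulf_neq0.
  lia.
have e2 : e ^+ 2 = 1 by case: e1 => ->; rewrite ?sqrrN expr1n.
pose W := M + (e * lam)%:M; rewrite -/W in rk.
have row_nz (p q : nat) (X : 'M[k]_(p, q)) : (0 < \rank X)%N -> exists i, row i X != 0.
  rewrite lt0n mxrank_eq0 => X0; apply/existsP; apply: contraNT X0.
  rewrite negb_exists => /forallP z; apply/eqP/row_matrixP=> i; rewrite row0.
  by apply/eqP; rewrite -[_ == _]negbK.
have [i1 s10] := row_nz _ _ W (ltnW rk); set s1 := row i1 W in s10.
(* [K] spans the coefficient vectors r with r W orthogonal to s1. It has codimension at most 1, so
   [K *m W] keeps rank at least rank W - 1 > 0. *)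
pose K := kermx (W *m G *m s1^T).
have rkK : (0 < \rank (K *m W))%N.
  have := mxrank_mul_min K W; rewrite mxrank_ker.
  have := rank_leq_col (W *m G *m s1^T); lia.
have [i2 s20] := row_nz _ _ _ rkK; rewrite row_mul in s20.
exists e, s1, (row i2 K *m W); split; split=> //.
- by rewrite /s1 rowE; exact: eig.
- exact: eig.
rewrite /bform -2!mulmxA [W *m (G *m _)]mulmxA -row_mul.
by rewrite [K *m _](sub_kermxP (submx_refl _)) row0 mxE.
Qed.

Hypothesis anA : anisotropic qA.

Lemma albert_neq0 x : x != 0 -> albert x x != 0.
Proof.
apply: contraNneq => x0; apply/eqP/anA; rewrite qf_valE -x0 albertE //.
Qed.

(* [A] is the matrix of the map [s |-> (u s u)~] on the skew elements; it is an
   isometry up to the factor [det u], which forces [A ^+ 2 = det u]. *)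
Lemma sandwich_matrix u lam : lam != 0 -> bq_sigma u = u ->
  \det (biquat_rep u) = f (lam ^+ 2) ->
  exists A : 'M[k]_6, (forall s, biquat_rep u *m skew_mx s *m biquat_rep u = skew_mx (tilde (s *m A))) /\
    A *m A = (lam ^+ 2)%:M.
Proof.
move=> l0 su du; set U := biquat_rep u.
have sU : Sigma U = U by rewrite /U -biquat_rep_sigma su.
have ex s : exists y, U *m skew_mx s *m U = skew_mx y.
  have := @biquat_rep_skew _ _ f a b c d iota al ga n2 a0 b0 c0 d0 al2 ga2 iota_sqr
    (bq_mul a b c d (bq_mul a b c d u (skew_vec iota s)) u).
  rewrite !biquat_rep_mul // -/U -/(skew_mx s) !Sigma_mul sU Sigma_skew_mx !(mulNmx, mulmxN) mulmxA.
  exact.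
have [g eg] := fin_all_exists (fun i => ex (delta_mx 0 i)).
pose A : 'M[k]_6 := \matrix_i tilde (g i); exists A.
have HA s : U *m skew_mx s *m U = skew_mx (tilde (s *m A)).
  rewrite mulmx_sum_row {1}[s]row_sum_delta.
  elim/big_rec2: _ => [|i x y _ IH]; first by rewrite tilde0 skew_mx0 mulmx0 mul0mx.
  rewrite tilde_lin !skew_mx_lin mulmxDr mulmxDl IH -scalemxAr -scalemxAl; congr (_ *: _ + _).
  by rewrite rowK tildeK eg.
split=> //.
have key (t : 'rV_6) : t *m A *m A = lam ^+ 2 *: t.
  have [->|t0] := eqVneq t 0; first by rewrite !mul0mx scaler0.
  have q0 : f (albert t t) != 0 by rewrite fmorph_eq0 albert_neq0.
  have qt : albert (t *m A) (t *m A) = lam ^+ 2 * albert t t.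
    have := albert_sandwich n2 a0 b0 c0 d0 al2 ga2 iota_sqr sU (HA t).
    by rewrite albert_tilde du -rmorphM => /fmorph_inj.
  have l2q : f (lam ^+ 2 * albert t t) != 0 by rewrite fmorph_eq0 mulf_neq0 ?expf_neq0 ?albert_neq0.
  (* Writing t' for tA, the products U t and U t' multiply to a nonzero scalar and hence commute;
     multiplying U t' U t by t~ on the right then evaluates U t' U. *)
  have := skew_mx_sqr_tilde (t *m A); rewrite qt -HA -mulmxA => /(scalar_mulC l2q) e.
  have : U *m skew_mx (t *m A) *m U = f (lam ^+ 2) *: skew_mx (tilde t).
    apply: (scalerI q0); rewrite -mul_mx_scalar -(skew_mx_sqr _ _ al2 ga2 iota_sqr) mulmxA.
    by rewrite -[_ *m U *m skew_mx t]mulmxA e mul_scalar_mx scalerA -rmorphM mulrC.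
  rewrite HA -skew_mxZ -tildeZ => /eqP; rewrite -subr_eq0 -scaleN1r.
  have -> x y : skew_mx (tilde x) + -1 *: skew_mx (tilde y) = skew_mx (tilde (-1 *: y + x)).
    by rewrite tilde_lin skew_mx_lin rmorphN1 addrC.
  move/eqP/(skew_mx_eq0 n2 a0 b0 c0 d0 al2 ga2 iota_sqr)/(congr1 (@tilde k)); rewrite tildeK tilde0.
  by rewrite addrC scaleN1r => /eqP; rewrite subr_eq0 => /eqP.
by apply/row_matrixP=> i; rewrite rowE [RHS]rowE mulmxA key mul_mx_scalar.
Qed.

(** For eigenvectors, u s u is a multiple of s~, so anticommutation of s1 and s2 carries over to s1
    u s2 = - s2 u s1. This says that s1 u s2 is skew. *)
Lemma orthogonal_triple_of_symmetric u lam : lam != 0 -> bq_sigma u = u ->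
  \det (biquat_rep u) = f (lam ^+ 2) ->
  exists eps s1 s2 s3, [/\ eps = 1 \/ eps = -1, s1 != 0, s2 != 0 & s3 != 0] /\
    [/\ albert s1 s2 = 0, albert s1 s3 = 0, albert s2 s3 = 0 &
        albert s3 s3 = - (eps * lam) * (albert s1 s1 * albert s2 s2)].
Proof.
move=> l0 su du; have [A [HA A2]] := sandwich_matrix l0 su du; set U := biquat_rep u in HA.
have sU : Sigma U = U by rewrite /U -biquat_rep_sigma su.
have uU : U \in unitmx by rewrite unitmxE du unitfE fmorph_eq0 expf_neq0.
have [eps [s1 [s2 [[e1 s10 s20] [E1 E2]]]]] := orthogonal_eigenvectors (gram qA) (isT : 3 < 6)%N l0 A2.
rewrite -albertE => o21; have o12 : albert s1 s2 = 0 by rewrite albertC.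
set la := eps * lam in E1 E2 *.
have e2 : eps ^+ 2 = 1 by case: e1 => ->; rewrite ?sqrrN expr1n.
have la0 : la != 0 by case: e1; rewrite /la => ->; rewrite ?mulN1r ?mul1r ?oppr_eq0.
have la2 : la ^+ 2 = lam ^+ 2 by rewrite exprMn e2 mul1r.
have F1 : U *m skew_mx s1 *m U = f la *: skew_mx (tilde s1) by rewrite HA E1 tildeZ skew_mxZ.
have F2 : U *m skew_mx s2 *m U = f la *: skew_mx (tilde s2) by rewrite HA E2 tildeZ skew_mxZ.
pose q1 := albert s1 s1; pose q2 := albert s2 s2.
have q10 : q1 != 0 by apply: albert_neq0.
have q20 : q2 != 0 by apply: albert_neq0.
have US12 : U *m (skew_mx s1 *m U *m skew_mx s2) = - (U *m (skew_mx s2 *m U *m skew_mx s1)).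
  rewrite !mulmxA F1 F2 -!scalemxAl -scalerN; congr (_ *: _).
  exact: skew_mx_anticomm_tilde.
have S12 : skew_mx s1 *m U *m skew_mx s2 = - (skew_mx s2 *m U *m skew_mx s1).
  by apply: (can_inj (mulKmx uU)); rewrite US12 mulmxN.
have [s3 S3] : exists s3, skew_mx s1 *m U *m skew_mx s2 = skew_mx s3.
  have := @biquat_rep_skew _ _ f a b c d iota al ga n2 a0 b0 c0 d0 al2 ga2 iota_sqr
    (bq_mul a b c d (bq_mul a b c d (skew_vec iota s1) u) (skew_vec iota s2)).
  rewrite !biquat_rep_mul // -/U -/(skew_mx s1) -/(skew_mx s2) !Sigma_mul sU !Sigma_skew_mx !(mulNmx, mulmxN) opprK mulmxA.
  by rewrite S12 opprK; apply.
pose q3 := albert s3 s3.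
have q3sq : q3 ^+ 2 = (la * (q1 * q2)) ^+ 2.
  apply: (fmorph_inj f); rewrite rmorphXn -(det_skew_mx n2 a0 b0 c0 d0 al2 ga2 iota_sqr) -S3 !det_mulmx.
  rewrite !(det_skew_mx n2 a0 b0 c0 d0 al2 ga2 iota_sqr) du -la2 -!rmorphXn -!rmorphM.
  by congr (f _); rewrite /q1 /q2; ring.
have q30 : q3 != 0.
  apply/eqP=> q0; move/eqP: q3sq; rewrite q0 expr0n eq_sym expf_eq0 /= (mulf_eq0 la) (mulf_eq0 q1).
  by rewrite (negPf la0) (negPf q10) (negPf q20).
(* The determinants give only the square of q(s3); the sign [th] stays open until the pairing of s1
   with s3 has been computed. *)
have [th [th1 q3E]] : exists th, (th = 1 \/ th = -1) /\ q3 = th * (la * (q1 * q2)).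
  move/eqP: q3sq; rewrite eqf_sqr => /orP[/eqP->|/eqP->]; first by exists 1; rewrite mul1r; split; [left|].
  by exists (-1); rewrite mulN1r; split; [right|].
(* s3~ is q(s3) times the inverse of s3 = s1 u s2. The candidate is checked by multiplying out: s2
   s2~ is scalar, and so is s1 (u s1 u). *)
have S3inv : skew_mx (tilde s3) = f th *: (skew_mx (tilde s2) *m skew_mx s1 *m U).
  have uS3 : skew_mx s3 \in unitmx.
    by rewrite unitmxE (det_skew_mx n2 a0 b0 c0 d0 al2 ga2 iota_sqr) unitfE expf_neq0 ?fmorph_eq0.
  apply: (can_inj (mulKmx uS3)); rewrite (skew_mx_sqr _ _ al2 ga2 iota_sqr) -/q3 -S3 -scalemxAr.
  rewrite -!mulmxA (mulmxA (skew_mx s2)) (skew_mx_sqr _ _ al2 ga2 iota_sqr) mul_scalar_mx -!scalemxAr.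
  rewrite (mulmxA U) F1 -scalemxAr (skew_mx_sqr _ _ al2 ga2 iota_sqr) !scale_scalar_mx.
  by rewrite -!rmorphM; congr (_%:M); congr (f _); rewrite q3E /q1 /q2; ring.
have S1US1 : skew_mx s1 *m U *m skew_mx s1 *m skew_mx (tilde s2) = f q1 *: (skew_mx s2 *m U).
  apply: (scalerI (_ : f la != 0)); first by rewrite fmorph_eq0.
  rewrite scalemxAr -F2.
  have -> : skew_mx s1 *m U *m skew_mx s1 *m (U *m skew_mx s2 *m U) = skew_mx s1 *m (U *m skew_mx s1 *m U) *m (skew_mx s2 *m U).
    by rewrite !mulmxA.
  by rewrite F1 -scalemxAr (skew_mx_sqr _ _ al2 ga2 iota_sqr) -scalemxAl mul_scalar_mx.
(* The pairing of s1 and s3 is a scalar on one side and (1 + th) times a multiple of s2 u on the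
   other, so th = -1 gives orthogonality. *)
have b13 : (f (2%:R * albert s1 s3))%:M = - f (1 + th) *: (f q1 *: (skew_mx s2 *m U)).
  rewrite -(skew_mx_polar _ _ al2 ga2 iota_sqr) S3inv -S3 -scalemxAr.
  rewrite -[skew_mx s1 *m U *m skew_mx s2 *m _]mulmxA (skew_mx_anticomm o21) mulmxN !mulmxA S1US1.
  rewrite (skew_mx_anticomm o12) !mulNmx -[skew_mx s2 *m skew_mx (tilde s1) *m skew_mx s1]mulmxA skew_mx_sqr_tilde mul_mx_scalar.
  rewrite -scalemxAl -/q1 (rmorphD f 1 th) rmorph1 scaleNr scalerDl scale1r opprD scalerN.
  by rewrite addrC.
(* Otherwise [s2 * u] would be a scalar, so that [u] would be skew. *)
have th_1 : th = -1.
  case: th1 => // th1; exfalso.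
  pose m := - f (1 + th) * f q1.
  have m0 : m != 0 by rewrite /m th1 mulNr oppr_eq0 mulf_neq0 ?fmorph_eq0.
  have e : (m * f q2) *: U = f (2%:R * albert s1 s3) *: skew_mx (tilde s2).
    rewrite -[RHS]mul_mx_scalar b13 scalerA -scalemxAr mulmxA skew_mx_sqr_tilde mul_scalar_mx scalerA.
    by rewrite /q2.
  have := congr1 (@Sigma L) e; rewrite -[_ *: U]addr0 Sigma_lin Sigma0 addr0 sU.
  rewrite -[_ *: skew_mx _]addr0 Sigma_lin Sigma0 addr0 Sigma_skew_mx scalerN -e => /eqP.
  rewrite -addr_eq0 -mulr2n -scaler_nat !scaler_eq0 mulf_eq0 (negPf m0) fmorph_eq0 (negPf q20).
  rewrite (negPf (two_neq0_ext f n2)) /= => /eqP U0; move: uU; rewrite U0 unitmxE det0.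
  by rewrite unitr0.
have z t : (f (2%:R * t))%:M = 0 :> 'M[L]_4 -> t = 0.
  move/matrixP/(_ 0 0)/eqP; rewrite !mxE mulr1n fmorph_eq0 mulf_eq0 (negPf n2).
  by move/eqP.
exists eps, s1, s2, s3; split; split=> //.
- apply: contraNneq q30 => s30; rewrite /q3 s30 /albert /coord !mxE; apply/eqP; ring.
- by apply: z; rewrite b13 th_1 subrr rmorph0 oppr0 scale0r.
- apply: z; rewrite -(skew_mx_polar _ _ al2 ga2 iota_sqr) S3inv -S3 th_1 rmorphN1 scaleN1r mulmxN.
  rewrite -[skew_mx s1 *m U *m skew_mx s2 *m _]mulmxA (skew_mx_sqr _ _ al2 ga2 iota_sqr) !mulmxA.
  by rewrite (skew_mx_sqr _ _ al2 ga2 iota_sqr) -mulmxA mul_scalar_mx mul_mx_scalar addNr.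
- by rewrite -/q3 q3E th_1 mulN1r mulNr.
Qed.

End Core.

(** * Reduced norms and Pfister decompositions *)

Lemma monic_fourth_root_inj (L : fieldType) (p q : {poly L}) : 2%:R != 0 :> L ->
  p \is monic -> q \is monic -> p ^+ 4 = q ^+ 4 -> p = q.
Proof.
move=> n2 mp mq /eqP.
have sg (r s : {poly L}) : r \is monic -> s \is monic -> r ^+ 2 = s ^+ 2 -> r = s.
  move=> mr ms /eqP; rewrite eqf_sqr => /orP[/eqP//|/eqP rs].
  have := eqP mr; rewrite rs lead_coefN (eqP ms) => /eqP.
  by rewrite eq_sym -addr_eq0 -mulr2n (negPf n2).
rewrite (exprM _ 2 2) (exprM q 2 2) => /eqP/sg e.
by apply: sg => //; apply: e; rewrite monic_exp.
Qed.

Lemma splitting_extension (k : fieldType) (a c : k) :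
  exists (L : fieldType) (f : {rmorphism k -> L}) (al ga : L),
    al ^+ 2 = f a /\ ga ^+ 2 = f c.
Proof.
have [L1 [f1 [r1 e1]]] := sqrt_extension a.
have [L [f2 [r2 e2]]] := sqrt_extension (f1 c).
exists L, (f2 \o f1 : {rmorphism k -> L}), (f2 r1), r2.
by rewrite -rmorphXn e1.
Qed.

(** Over [L] the characteristic polynomial of left multiplication is the fourth power of that of the
    4 x 4 matrix. Uniqueness of monic fourth roots gives one direction; descent gives the other, by
    producing the reduced characteristic polynomial over [k]. *)
Lemma bq_Nrd_det (k L : fieldType) (f : {rmorphism k -> L}) (a b c d : k) (al ga : L)
    (u : 'M[k]_4) (x : k) :
  2%:R != 0 :> k -> a != 0 -> b != 0 -> c != 0 -> d != 0 ->
  al ^+ 2 = f a -> ga ^+ 2 = f c ->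
  bq_Nrd_is a b c d u x <-> \det (biquat_rep f b d al ga u) = f x.
Proof.
move=> n2 a0 b0 c0 d0 al2 ga2; set U := biquat_rep f b d al ga u.
have n2' : 2%:R != 0 :> L by rewrite -(rmorph_nat f) fmorph_eq0.
have eU : map_poly f (char_poly (bq_Lmat a b c d u)) = char_poly U ^+ 4.
  exact: map_char_poly_Lmat.
have det0 : (char_poly U)`_0 = \det U by rewrite char_poly_det -signr_odd expr0 mul1r.
split=> [[p [mp sp p4 ->]]|dU].
  rewrite -det0 -coef_map; suff -> : char_poly U = map_poly f p by [].
  apply: monic_fourth_root_inj => //.
  - exact: char_poly_monic.
  - by rewrite map_monic.
  - by rewrite -eU -p4 rmorphXn.
have [p ep] := fourth_root_descent n2 (char_poly_monic U) (esym eU).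
exists p; split.
- by rewrite -(map_monic f) ep char_poly_monic.
- by rewrite -(size_map_poly f) ep size_char_poly.
- by apply: (map_poly_inj f); rewrite rmorphXn /= ep eU.
- by apply: (fmorph_inj f); rewrite -coef_map ep det0 dU.
Qed.

Section Shape.
Variables (k : fieldType) (iota : k).
Hypotheses (iota_sqr : iota ^+ 2 = -1).

(** A congruence changes the determinant by a square, and the target form has determinant
    (abcd)^2. *)
Lemma congruent_discr6 (x1 x2 x3 x4 x5 x6 a b c d : k) :
  congruent [:: x1; x2; x3; x4; x5; x6] [:: a; b; a * b; c; d; c * d] ->
  exists r, x1 * x2 * x3 * x4 * x5 * x6 = r ^+ 2.
Proof.
case=> P [_ /(congr1 determinant)]; rewrite !det_mulmx det_tr !det_diag.
rewrite !big_ord_recl !big_ord0 !mxE /= => e.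
exists (\det (P : 'M_6) * (a * b * (c * d))).
transitivity (x1 * (x2 * (x3 * (x4 * (x5 * (x6 * 1)))))); first by ring.
by rewrite -e; ring.
Qed.

Lemma scale_pfister_shape (lam eps x1 x2 x3 x4 x5 x6 r : k) : lam != 0 -> eps = 1 \/ eps = -1 ->
  x1 != 0 -> x2 != 0 -> x4 != 0 -> x5 != 0 ->
  x3 = - (eps * lam) * (x1 * x2) -> x1 * x2 * x3 * x4 * x5 * x6 = r ^+ 2 ->
  exists x y z w, [/\ x != 0, y != 0, z != 0 & w != 0] /\
    congruent (scale lam [:: x1; x2; x3; x4; x5; x6]) [:: x; y; x * y; z; w; z * w].
Proof.
move=> l0 eps1 x10 x20 x40 x50 e3 er.
(* The sign left by the choice of eigenvalue becomes a square; only eps = 1 calls for [iota]. *)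
have [e ee] : exists e, e ^+ 2 = - eps.
  case: eps1 => ->; first by exists iota; rewrite iota_sqr.
  by exists 1; rewrite expr1n opprK.
have eps2 : eps ^+ 2 = 1 by case: eps1 => ->; rewrite ?sqrrN expr1n.
exists (lam * x1), (lam * x2), (lam * x4), (lam * x5); split; first by rewrite !mulf_neq0.
rewrite /scale /=.
have -> : lam * x3 = (lam * x1) * (lam * x2) * e ^+ 2 by rewrite ee e3; ring.
(* The square factor results from solving the discriminant relation for x6 and substituting x3. *)
have -> : lam * x6 = (lam * x4) * (lam * x5) * (e * r / (lam * x1 * x2 * x4 * x5)) ^+ 2.
  rewrite !exprMn ee -er e3 -[lam * x6 in LHS]mul1r -eps2; field.
  by rewrite l0 x10 x20 x40 x50.
do 2![apply: congruent_cons].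
apply: congruent_trans (congruent_sqr _ _ _) _; do 3![apply: congruent_cons].
exact: congruent_sqr.
Qed.

End Shape.

Theorem theorem3p2 (k : fieldType) (a b c d : k) (q : seq k) (lam : k) :
  (2%:R != 0 :> k) ->
  (exists i : k, i ^+ 2 = -1) ->
  a != 0 -> b != 0 -> c != 0 -> d != 0 ->
  isometric q [:: a; b; a * b; c; d; c * d] ->
  anisotropic q ->
  lam != 0 ->
  Pf2_is (scale lam q) 2 <->
  exists u : 'M[k]_4, bq_sigma u = u /\ bq_Nrd_is a b c d u (lam ^+ 2).
Proof.
move=> n2 [iota iota_sqr] a0 b0 c0 d0 isoq anq l0.
set qA := [:: a; b; a * b; c; d; c * d] in isoq *.
have cq : congruent q qA by apply/isometricP => //; apply: anisotropic_nondeg.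
have anA : anisotropic qA := anisotropic_isometric isoq anq.
have sq : size (scale lam q) = 6 by rewrite size_map (congruent_size cq).
have anl : anisotropic (scale lam q) by apply: anisotropic_scale.
have ndl := anisotropic_nondeg anl.
have [L [f [al [ga [al2 ga2]]]]] := splitting_extension a c.
split=> [[/(Pf2_rep2P n2 iota_sqr sq ndl)[x [y [z [w [[x0 y0 z0 w0] cl]]]]] _]|[u [su nu]]].
  have cT : congruent [:: x; y; x * y; z; w; z * w] (scale lam qA).
    exact: congruent_trans (congruent_sym ndl cl) (congruent_scale lam cq).
  (* The rows of [P] are orthogonal vectors on which lambda q takes the listed values; the first
     three provide the triple. *)
  have [P eP] := (@congruent_sizeP _ 6 [:: x; y; x * y; z; w; z * w] (scale lam qA) erefl erefl).1 cT.
  have E (i j : 'I_6) : lam * albert a b c d (row i P) (row j P) =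
      gram_size 6 [:: x; y; x * y; z; w; z * w] i j.
    rewrite -eP albertE /bform.
    have -> : gram_size 6 (scale lam qA) = lam *: gram qA.
      by apply/matrixP=> r s; rewrite !mxE (nth_map 0) // mulrnAr.
    rewrite -scalemxAr -scalemxAl [RHS]mxE; congr (_ * _).
    by rewrite -row_mul mxE [RHS]mxE; apply: eq_bigr => r _; rewrite !mxE.
  pose s (i : nat) := row (inord i : 'I_6) P.
  have O (i j : nat) : (i < 6)%N -> (j < 6)%N -> i != j -> albert a b c d (s i) (s j) = 0.
    move=> li lj ne; apply: (mulfI l0); rewrite mulr0 E !mxE -val_eqE /= !inordK //.
    by rewrite (negPf ne).
  have Q (i : nat) : (i < 6)%N -> lam * albert a b c d (s i) (s i) =
      [:: x; y; x * y; z; w; z * w]`_i.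
    by move=> li; rewrite E !mxE eqxx inordK.
  have [u [su du]] := symmetric_of_orthogonal_triple n2 a0 b0 c0 d0 al2 ga2 iota_sqr l0 x0 y0
    (Q 0%N isT) (Q 1%N isT) (Q 2%N isT) (O 0%N 1%N isT isT isT) (O 0%N 2%N isT isT isT)
    (O 1%N 2%N isT isT isT).
  by exists u; split=> //; exact: (bq_Nrd_det u (lam ^+ 2) n2 a0 b0 c0 d0 al2 ga2).2 du.
split; last by move=> m lt2; apply: anisotropic_Pf2_ge2.
have du := (bq_Nrd_det u (lam ^+ 2) n2 a0 b0 c0 d0 al2 ga2).1 nu.
have [eps [s1 [s2 [s3 [[eps1 s10 s20 s30] [o12 o13 o23 q3]]]]]] :=
  orthogonal_triple_of_symmetric n2 a0 b0 c0 d0 al2 ga2 iota_sqr anA l0 su du.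
(* Three more vectors complete the triple to an orthogonal basis; anisotropy makes their values
   nonzero. *)
have [s4 s40 o4] := @orthogonal_vector _ 6 (gram qA) [:: s1; s2; s3] isT.
have [s5 s50 o5] := @orthogonal_vector _ 6 (gram qA) [:: s1; s2; s3; s4] isT.
have [s6 s60 o6] := @orthogonal_vector _ 6 (gram qA) [:: s1; s2; s3; s4; s5] isT.
have o y l s : (forall y, y \in l -> bform (gram qA) s y = 0) -> y \in l ->
    albert a b c d s y = 0 /\ albert a b c d y s = 0.
  by move=> os yl; rewrite (albertC _ _ _ _ y) albertE os.
have [[o41 o14] [o42 o24] [o43 o34]] : [/\ albert a b c d s4 s1 = 0 /\ albert a b c d s1 s4 = 0,
    albert a b c d s4 s2 = 0 /\ albert a b c d s2 s4 = 0 & albert a b c d s4 s3 = 0 /\ albert a b c d s3 s4 = 0].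
  by split; apply: o o4 _; rewrite !inE eqxx ?orbT.
have [[o51 o15] [o52 o25] [o53 o35] [o54 o45]] :
   [/\ albert a b c d s5 s1 = 0 /\ albert a b c d s1 s5 = 0, albert a b c d s5 s2 = 0 /\ albert a b c d s2 s5 = 0,
    albert a b c d s5 s3 = 0 /\ albert a b c d s3 s5 = 0 & albert a b c d s5 s4 = 0 /\ albert a b c d s4 s5 = 0].
  by split; apply: o o5 _; rewrite !inE eqxx ?orbT.
have [[o61 o16] [o62 o26] [o63 o36] [o64 o46] [o65 o56]] :
   [/\ albert a b c d s6 s1 = 0 /\ albert a b c d s1 s6 = 0, albert a b c d s6 s2 = 0 /\ albert a b c d s2 s6 = 0,
    albert a b c d s6 s3 = 0 /\ albert a b c d s3 s6 = 0, albert a b c d s6 s4 = 0 /\ albert a b c d s4 s6 = 0 &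
    albert a b c d s6 s5 = 0 /\ albert a b c d s5 s6 = 0].
  by split; apply: o o6 _; rewrite !inE eqxx ?orbT.
have [o21 o31 o32] : [/\ albert a b c d s2 s1 = 0, albert a b c d s3 s1 = 0 & albert a b c d s3 s2 = 0].
  by split; rewrite albertC.
have cb : congruent [:: albert a b c d s1 s1; albert a b c d s2 s2; albert a b c d s3 s3;
    albert a b c d s4 s4; albert a b c d s5 s5; albert a b c d s6 s6] qA.
  rewrite !albertE; apply: (@congruent_orthogonal_basis _ qA [:: s1; s2; s3; s4; s5; s6]) => // i j.
  rewrite -albertE; case: i j => [|[|[|[|[|[|i]]]]]] [|[|[|[|[|[|j]]]]]] //= _ _ _.
have nz s : s != 0 -> albert a b c d s s != 0 by apply: albert_neq0.
have [r er] := congruent_discr6 cb.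
have [x [y [z [w [xyzw cs]]]]] := scale_pfister_shape iota_sqr l0 eps1 (nz _ s10) (nz _ s20)
  (nz _ s40) (nz _ s50) q3 er.
apply/(Pf2_rep2P n2 iota_sqr sq ndl); exists x, y, z, w; split=> //.
have ndb : nondeg [:: albert a b c d s1 s1; albert a b c d s2 s2; albert a b c d s3 s3;
    albert a b c d s4 s4; albert a b c d s5 s5; albert a b c d s6 s6].
  by rewrite /nondeg /= !nz.
exact: congruent_trans (congruent_scale lam (congruent_trans cq (congruent_sym ndb cb))) cs.
Qed.
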